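(* Let $G$ be a $2$-Engel group of nilpotency class exactly $3$. Then $B(3,G)$ is not an Eilenberg–MacLane space of type $K(\pi,1)$ (for any group $\pi$).
   Context: With $[x,y]=x^{-1}y^{-1}xy$ and $[x,y,z]=[[x,y],z]$, a group $G$ is $2$-Engel if $[x,y,y]=1$ for all $x,y\in G$. A tuple $(x_0,\dots,x_k)\in G^{k+1}$ is called affinely nil-$2$ if there exist $y\in G$ and a subgroup $H\leq G$, nilpotent of class at most $2$, such that $x_i\in yH$ for all $i$. $E_\ast(3,G)$ is the simplicial set whose $k$-simplices are the affinely nil-$2$ tuples $(x_0,\dots,x_k)\in G^{k+1}$, with face maps $d_i$ omitting the $i$-th coordinate and degeneracy maps $s_i$ repeating the $i$-th coordinate; $E(3,G)$ is its geometric realization. The group $G$ acts freely on $E(3,G)$ by left translation, $g\cdot(x_0,\dots,x_k)=(gx_0,\dots,gx_k)$, and $B(3,G):=E(3,G)/G$ is the quotient (so $E(3,G)\to B(3,G)$ is a covering). *)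

(* Defs.v *)
From HB Require Import structures.
From Stdlib Require Import Relation_Operators Operators_Properties.
From mathcomp Require Import all_boot all_order all_algebra zify lra.
From mathcomp Require Import all_classical all_reals topology normedtype.

Set Implicit Arguments.
Unset Strict Implicit.
Unset Printing Implicit Defensive.

Import Order.TTheory GRing.Theory Num.Theory.
Import numFieldNormedType.Exports.

Local Open Scope classical_set_scope.
Local Open Scope ring_scope.
Local Open Scope quotient_scope.

Definition two_engel (G : groupType) : Prop :=
  forall x y : G, [~ x, y, y]%g = 1%g.

Definition is_subgroup (G : groupType) (H : set G) : Prop :=
  [/\ H 1%g, forall x y, H x -> H y -> H (x * y)%g & forall x, H x -> H x^-1%g].

(* [lcs H n] is the term usually written gamma_(n+1)(H). *)
Fixpoint lcs (G : groupType) (H : set G) (n : nat) : set G :=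
  if n is m.+1 then
    smallest (@is_subgroup G)
      [set z | exists x y, [/\ lcs H m x, H y & z = [~ x, y]%g]]
  else H.

Definition nilpotent_le (G : groupType) (c : nat) (H : set G) : Prop :=
  lcs H c = [set 1%g].

Definition nilpotency_class (G : groupType) (c : nat) (H : set G) : Prop :=
  nilpotent_le c H /\ forall k, nilpotent_le k H -> (c <= k)%N.

Definition equiv_gen (T : Type) (r : T -> T -> Prop) : rel T :=
  fun x y => `[< clos_refl_sym_trans T r x y >].

Lemma equiv_gen_refl (T : Type) (r : T -> T -> Prop) : reflexive (equiv_gen r).
Proof. by move=> x; apply/asboolP; exact: rst_refl. Qed.

Lemma equiv_gen_sym (T : Type) (r : T -> T -> Prop) : symmetric (equiv_gen r).
Proof. by move=> x y; apply: asbool_equiv_eq; split; exact: rst_sym. Qed.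

Lemma equiv_gen_trans (T : Type) (r : T -> T -> Prop) :
  transitive (equiv_gen r).
Proof.
by move=> y x z /asboolP xy /asboolP yz; apply/asboolP; exact: rst_trans yz.
Qed.

Canonical equiv_gen_equiv (T : Type) (r : T -> T -> Prop) :=
  EquivRel (equiv_gen r) (@equiv_gen_refl T r) (@equiv_gen_sym T r)
    (@equiv_gen_trans T r).

Definition quotient_by (T : choiceType) (r : T -> T -> Prop) :=
  {eq_quot equiv_gen r}.

Definition quotient_space (T : topologicalType) (r : T -> T -> Prop) :
  topologicalType := quotient_topology (quotient_by r).

Definition class_of (T : topologicalType) (r : T -> T -> Prop) (x : T) :
  quotient_space r := \pi_(quotient_by r) x.

Definition rep_of (T : topologicalType) (r : T -> T -> Prop)
  (p : quotient_space r) : T := repr (p : quotient_by r).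

Lemma class_ofP (T : topologicalType) (r : T -> T -> Prop) (x y : T) :
  class_of r x = class_of r y <-> clos_refl_sym_trans T r x y.
Proof.
have e := @eqmodP T (equiv_gen_equiv r) x y.
by split=> [/e/asboolP|xy]; last by apply/e/asboolP.
Qed.

Lemma rep_ofK (T : topologicalType) (r : T -> T -> Prop)
  (p : quotient_space r) : class_of r (rep_of p) = p.
Proof. exact: (@reprK _ (quotient_by r)). Qed.

(* The monotone surjection [n+1] -> [n] taking the value i twice. *)
Fact ord_codegen_subproof n (i : 'I_n.+1) (j : 'I_n.+2) : (unbump i j < n.+1)%N.
Proof. by rewrite /unbump; have := ltn_ord i; have := ltn_ord j; lia. Qed.

Definition ord_codegen n (i : 'I_n.+1) (j : 'I_n.+2) : 'I_n.+1 :=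
  Ordinal (ord_codegen_subproof i j).

Definition ordW n (i : 'I_n) : 'I_n.+1 := widen_ord (leqnSn n) i.
Definition ordSn n (i : 'I_n) : 'I_n.+1 := lift ord0 i.

(* The laws are the simplicial identities, each indexed so that both sides
   typecheck without index subtraction: [ordW i] and [ordSn i] have values
   i and i.+1. *)
Record simplicialSet := SimplicialSet {
  simplices :> nat -> choiceType;
  face : forall n, 'I_n.+2 -> simplices n.+1 -> simplices n;
  degen : forall n, 'I_n.+1 -> simplices n -> simplices n.+1;
  face_face : forall n (i j : 'I_n.+2) (x : simplices n.+2), (i <= j)%N ->
    face i (face (ordSn j) x) = face j (face (ordW i) x);
  degen_degen : forall n (i j : 'I_n.+1) (x : simplices n), (i <= j)%N ->
    degen (ordSn j) (degen i x) = degen (ordW i) (degen j x);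
  face_degen_lt : forall n (i : 'I_n.+2) (j : 'I_n.+1) (x : simplices n.+1),
    (i <= j)%N -> face (ordW i) (degen (ordSn j) x) = degen j (face i x);
  face_degen_eq : forall n (j : 'I_n.+1) (x : simplices n),
    face (ordW j) (degen j x) = x;
  face_degen_eqS : forall n (j : 'I_n.+1) (x : simplices n),
    face (ordSn j) (degen j x) = x;
  face_degen_gt : forall n (i : 'I_n.+2) (j : 'I_n.+1) (x : simplices n.+1),
    (j < i)%N -> face (ordSn i) (degen (ordW j) x) = degen j (face i x)
}.

Definition std_simplex (R : realType) (n : nat) : set 'rV[R]_n.+1 :=
  [set t | (forall i, 0 <= t ord0 i) /\ \sum_i t ord0 i = 1].
Arguments std_simplex : clear implicits.

Fact push_subproof (R : realType) m n (f : 'I_m.+1 -> 'I_n.+1)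
    (t : std_simplex R m) :
  (\row_j \sum_(i | f i == j) val t ord0 i) \in std_simplex R n.
Proof.
apply/mem_set; have [t0 t1] := set_mem (valP t).
split=> [j|]; first by rewrite mxE; apply: sumr_ge0.
under eq_bigr do rewrite mxE.
by rewrite -t1 (partition_big f xpredT).
Qed.

(* The affine map of simplices induced by a map of vertices. *)
Definition push (R : realType) m n (f : 'I_m.+1 -> 'I_n.+1)
    (t : std_simplex R m) : std_simplex R n := 
  exist (fun u => u \in std_simplex R n) _ (push_subproof f t).

Section Realization.
Context (R : realType) (X : simplicialSet).

(* The disjoint union of one copy of the standard n-simplex for each
   n-simplex of X, with the coproduct topology. *)
Definition cells : topologicalType :=
  {s : {n & X n} & std_simplex R (tag s)}.

Definition cell n (x : X n) (t : std_simplex R n) : cells :=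
  existT (fun s : {n & X n} => std_simplex R (tag s) : topologicalType)
    (existT (fun n => X n) n x) t.

Inductive glue : cells -> cells -> Prop :=
| glue_face n (i : 'I_n.+2) (x : X n.+1) (t : std_simplex R n) :
    glue (cell (face i x) t) (cell x (push (lift i) t))
| glue_degen n (i : 'I_n.+1) (x : X n) (t : std_simplex R n.+1) :
    glue (cell (degen i x) t) (cell x (push (ord_codegen i) t)).

Definition realization : topologicalType := quotient_space glue.

Definition rpoint n (x : X n) (t : std_simplex R n) : realization :=
  class_of glue (cell x t).

End Realization.

Record simplicialMap (X Y : simplicialSet) := SimplicialMap {
  smap : forall n, X n -> Y n;
  smap_face : forall n (i : 'I_n.+2) (x : X n.+1),
    smap (face i x) = face i (smap x);
  smap_degen : forall n (i : 'I_n.+1) (x : X n),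
    smap (degen i x) = degen i (smap x)
}.

Section RealizationMap.
Context (R : realType) (X Y : simplicialSet) (f : simplicialMap X Y).

Definition cell_map (c : cells R X) : cells R Y :=
  cell (smap f (tagged (tag c))) (tagged c).

Definition realization_map (p : realization R X) : realization R Y :=
  class_of (@glue R Y) (cell_map (rep_of p)).

Lemma realization_mapE n (x : X n) (t : std_simplex R n) :
  realization_map (rpoint x t) = rpoint (smap f x) t.
Proof.
apply/class_ofP; rewrite -[cell (smap f x) t]/(cell_map (cell x t)).
have /class_ofP : class_of (@glue R X) (rep_of (rpoint x t)) =
  class_of (@glue R X) (cell x t) by rewrite rep_ofK.
elim=> [_ _ [m i z u|m i z u]|c|c d _|c d e _ + _].
- by rewrite /cell_map /= smap_face; apply: rst_step; exact: glue_face.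
- by rewrite /cell_map /= smap_degen; apply: rst_step; exact: glue_degen.
- exact: rst_refl.
- exact: rst_sym.
- exact: rst_trans.
Qed.

End RealizationMap.

Section E3.
Context (G : groupType).

Definition affinely_nil2 k : set {ffun 'I_k.+1 -> G} :=
  [set x | exists (y : G) (H : set G), [/\ is_subgroup H, nilpotent_le 2 H &
     forall i, exists2 h, H h & x i = (y * h)%g]].
Arguments affinely_nil2 : clear implicits.

Fact affinely_nil2_reindex k l (f : 'I_l.+1 -> 'I_k.+1)
    (x : affinely_nil2 k) :
  [ffun i => val x (f i)] \in affinely_nil2 l.
Proof.
apply/mem_set; have [y [H [sH nH Hx]]] := set_mem (valP x).
by exists y, H; split=> // i; rewrite ffunE.
Qed.

Definition reindex k l (f : 'I_l.+1 -> 'I_k.+1) (x : affinely_nil2 k) :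
  affinely_nil2 l := 
  exist (fun u => u \in affinely_nil2 l) _ (affinely_nil2_reindex f x).

Lemma reindex_comp k l m (f : 'I_l.+1 -> 'I_k.+1) (g : 'I_m.+1 -> 'I_l.+1)
    (x : affinely_nil2 k) : reindex g (reindex f x) = reindex (f \o g) x.
Proof. by apply/val_inj/ffunP => i /=; rewrite !ffunE. Qed.

Lemma eq_reindex k l (f g : 'I_l.+1 -> 'I_k.+1) (x : affinely_nil2 k) :
  f =1 g -> reindex f x = reindex g x.
Proof. by move=> fg; apply/val_inj/ffunP => i /=; rewrite !ffunE fg. Qed.

Lemma reindex_id k (f : 'I_k.+1 -> 'I_k.+1) (x : affinely_nil2 k) :
  f =1 id -> reindex f x = x.
Proof. by move=> fg; apply/val_inj/ffunP => i /=; rewrite !ffunE fg. Qed.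

Definition E3_face k (i : 'I_k.+2) : affinely_nil2 k.+1 -> affinely_nil2 k :=
  reindex (lift i).

Definition E3_degen k (i : 'I_k.+1) : affinely_nil2 k -> affinely_nil2 k.+1 :=
  reindex (ord_codegen i).

Ltac ord_lia :=
  intros; rewrite /E3_face /E3_degen ?reindex_comp;
  first [apply: eq_reindex | apply: reindex_id] => ?; apply/val_inj;
  rewrite /= ?/bump ?/unbump ?/bump /=; lia.

Fact E3_face_face k (i j : 'I_k.+2) x : (i <= j)%N ->
  E3_face i (E3_face (ordSn j) x) = E3_face j (E3_face (ordW i) x).
Proof. ord_lia. Qed.

Fact E3_degen_degen k (i j : 'I_k.+1) x : (i <= j)%N ->
  E3_degen (ordSn j) (E3_degen i x) = E3_degen (ordW i) (E3_degen j x).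
Proof. ord_lia. Qed.

Fact E3_face_degen_lt k (i : 'I_k.+2) (j : 'I_k.+1) x : (i <= j)%N ->
  E3_face (ordW i) (E3_degen (ordSn j) x) = E3_degen j (E3_face i x).
Proof. ord_lia. Qed.

Fact E3_face_degen_eq k (j : 'I_k.+1) x : E3_face (ordW j) (E3_degen j x) = x.
Proof. ord_lia. Qed.

Fact E3_face_degen_eqS k (j : 'I_k.+1) x : E3_face (ordSn j) (E3_degen j x) = x.
Proof. ord_lia. Qed.

Fact E3_face_degen_gt k (i : 'I_k.+2) (j : 'I_k.+1) x : (j < i)%N ->
  E3_face (ordSn i) (E3_degen (ordW j) x) = E3_degen j (E3_face i x).
Proof. ord_lia. Qed.

Definition E3_sset : simplicialSet :=
  @SimplicialSet (fun k => affinely_nil2 k : choiceType) E3_face E3_degen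
    E3_face_face E3_degen_degen E3_face_degen_lt E3_face_degen_eq
    E3_face_degen_eqS E3_face_degen_gt.

Fact translate_subproof (g : G) k (x : affinely_nil2 k) :
  [ffun i => (g * val x i)%g] \in affinely_nil2 k.
Proof.
apply/mem_set; have [y [H [sH nH Hx]]] := set_mem (valP x).
exists (g * y)%g, H; split=> // i; have [h Hh xh] := Hx i.
by exists h => //; rewrite ffunE xh mulgA.
Qed.

Definition translate (g : G) k (x : affinely_nil2 k) : affinely_nil2 k :=
  exist (fun u => u \in affinely_nil2 k) _ (translate_subproof g x).

Fact translate_reindex (g : G) k l (f : 'I_l.+1 -> 'I_k.+1)
    (x : affinely_nil2 k) :
  translate g (reindex f x) = reindex f (translate g x).
Proof. by apply/val_inj/ffunP => i /=; rewrite !ffunE. Qed.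

Definition translate_smap (g : G) : simplicialMap E3_sset E3_sset :=
  @SimplicialMap E3_sset E3_sset (translate g)
    (fun n i => translate_reindex g (lift i))
    (fun n i => translate_reindex g (ord_codegen i)).

Context (R : realType).

Definition E3 : topologicalType := realization R E3_sset.

Definition E3_act (g : G) : E3 -> E3 := realization_map (translate_smap g).

Definition E3_orbit (p q : E3) : Prop := exists g : G, q = E3_act g p.

Lemma E3_act1 (p : E3) : E3_act 1%g p = p.
Proof.
rewrite -(rep_ofK p); case: (rep_of p) => -[n x] t.
rewrite [LHS](realization_mapE (translate_smap 1%g) x t) /=.
suff -> : translate 1%g x = x by [].
by apply/val_inj/ffunP => i /=; rewrite ffunE mul1g.
Qed.

Lemma E3_actM (g h : G) (p : E3) : E3_act (g * h)%g p = E3_act g (E3_act h p).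
Proof.
rewrite -(rep_ofK p); case: (rep_of p) => -[n x] t.
rewrite [LHS](realization_mapE (translate_smap (g * h)%g) x t).
rewrite -[class_of _ _]/(rpoint (x : E3_sset n) t).
rewrite /E3_act !realization_mapE /=.
suff -> : translate (g * h)%g x = translate g (translate h x) by [].
by apply/val_inj/ffunP => i /=; rewrite !ffunE mulgA.
Qed.

(* By the two lemmas above [E3_orbit] is already an equivalence relation, so
   B3 is the orbit space. *)
Definition B3 : topologicalType := quotient_space E3_orbit.

End E3.
Arguments affinely_nil2 : clear implicits.

Section Homotopy.
Context (R : realType).

Definition cube n : set 'rV[R]_n :=
  [set t | forall i, 0 <= t ord0 i <= 1].
Arguments cube : clear implicits.

Definition cube_boundary n : set 'rV[R]_n :=
  [set t | cube n t /\ exists i, t ord0 i = 0 \/ t ord0 i = 1].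
Arguments cube_boundary : clear implicits.

Context (X : topologicalType).

(* Only the values on the cube matter; two loops agreeing there are
   homotopic in the sense of [homotopic] below. *)
Record nloop n (x0 : X) := NLoop {
  nloop_fun :> 'rV[R]_n -> X;
  nloop_cts : {within cube n, continuous nloop_fun};
  nloop_boundary : forall t, cube_boundary n t -> nloop_fun t = x0
}.
Arguments nloop_cts {n x0}.

Definition homotopic n (x0 : X) (f g : nloop n x0) : Prop :=
  exists H : 'rV[R]_n * R -> X,
    [/\ {within cube n `*` `[0, 1], continuous H},
        forall t, cube n t -> H (t, 0) = f t,
        forall t, cube n t -> H (t, 1) = g t &
        forall t s, cube_boundary n t -> 0 <= s <= 1 -> H (t, s) = x0].

(* [homotopic] is already an equivalence relation, so the closure taken by
   [quotient_by] adds nothing. *)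
Definition homotopy_group n (x0 : X) :=
  @quotient_by {classic nloop n x0} (@homotopic n x0).

Definition hclass n (x0 : X) (f : nloop n x0) : homotopy_group n x0 :=
  \pi_(homotopy_group n x0) (f : {classic nloop n x0}).

Definition set_coord0 n (t : 'rV[R]_n.+1) (s : R) : 'rV[R]_n.+1 :=
  \row_j (if j == ord0 then s else t ord0 j).

Definition concat_fun n (f g : 'rV[R]_n.+1 -> X) (t : 'rV[R]_n.+1) : X :=
  if t ord0 ord0 <= 2^-1 then f (set_coord0 t (2 * t ord0 ord0))
  else g (set_coord0 t (2 * t ord0 ord0 - 1)).

Lemma coord0_cts n : continuous (fun t : 'rV[R]_n.+1 => t ord0 ord0).
Proof. exact: coord_continuous. Qed.

Lemma set_coord0_cts n (a b : R) :
  continuous (fun t : 'rV[R]_n.+1 => set_coord0 t (a * t ord0 ord0 + b)).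
Proof.
move=> t A /= [P /= Pnbhs PA].
suff : \forall s \near t, forall i j,
    P i j (set_coord0 s (a * s ord0 ord0 + b) i j).
  by apply: filterS => s; exact: PA.
apply: (@filter_forall _ _ (fun i s => forall j,
  P i j (set_coord0 s (a * s ord0 ord0 + b) i j)) (nbhs t)) => i.
apply: (@filter_forall _ _ (fun j s =>
  P i j (set_coord0 s (a * s ord0 ord0 + b) i j)) (nbhs t)) => j.
have := Pnbhs i j; rewrite mxE; case: ifPn => [/eqP j0|j0] nP.
  have : {for t, continuous (fun s : 'rV[R]_n.+1 => a * s ord0 ord0 + b)}.
    apply: (@continuous_comp _ _ _ (fun s : 'rV[R]_n.+1 => s ord0 ord0)
      (fun x => a * x + b)); first exact: coord0_cts.
    apply: (@continuousD _ R^o R^o (fun x => a * x) (fun=> b)).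
      exact: mulrl_continuous.
    exact: cvg_cst.
  move=> /(_ _ nP) fP; apply: (@filterS _ (nbhs t) _ _ _ _ fP) => s /=.
  by rewrite mxE j0 eqxx.
have : {for t, continuous (fun s : 'rV[R]_n.+1 => s ord0 j)}.
  exact: coord_continuous.
move=> /(_ _ nP) fP; apply: (@filterS _ (nbhs t) _ _ _ _ fP) => s /=.
by rewrite mxE (negPf j0).
Qed.

Lemma comp_within (T : topologicalType) (A B : set T) (f : T -> X) (h : T -> T) :
  continuous h -> (forall t, A t -> B (h t)) ->
  {within B, continuous f} -> {within A, continuous (f \o h)}.
Proof.
move=> ch AB /subspace_continuousP cf; apply/subspace_continuousP => t At.
apply: cvg_trans (cf _ (AB _ At)).
move=> U /= /ch; rewrite /= !nbhs_simpl/= /within/= => tU.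
by apply: filterS tU => s hs As; apply: hs; exact: AB.
Qed.

Lemma eq_within (T : topologicalType) (A : set T) (f g : T -> X) :
  (forall t, A t -> f t = g t) ->
  {within A, continuous f} -> {within A, continuous g}.
Proof.
by move=> fg; apply: subspace_eq_continuous => t /set_mem; exact: fg.
Qed.

Lemma closed_cube n : closed (cube n).
Proof.
rewrite (_ : cube n = \bigcap_(i in [set: 'I_n])
    (fun t : 'rV[R]_n => t ord0 i) @^-1` `[0, 1]).
  apply: closed_bigI => i _; apply: preimage_closed; last exact: itv_closed.
  by move=> t _; exact: coord_continuous.
apply/seteqP; split=> t /= ct i; first by rewrite /= in_itv/=.
by have := ct i Logic.I; rewrite /= in_itv.
Qed.

Fact concat_cts n (x0 : X) (f g : nloop n.+1 x0) :
  {within cube n.+1, continuous (concat_fun f g)}.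
Proof.
pose lo : set 'rV[R]_n.+1 := [set t | t ord0 ord0 <= 2^-1].
pose hi : set 'rV[R]_n.+1 := [set t | 2^-1 <= t ord0 ord0].
rewrite (_ : cube n.+1 = (cube n.+1 `&` lo) `|` (cube n.+1 `&` hi)); last first.
  rewrite -setIUr; apply/esym/setIidPl => t _ /=.
  by case: (leP (t ord0 ord0) 2^-1) => [|/ltW]; [left|right].
apply: withinU_continuous.
- apply: closedI; first exact: closed_cube.
  apply: (@preimage_closed _ R (fun t : 'rV[R]_n.+1 => t ord0 ord0)
    [set x | x <= 2^-1]); last exact: closed_le.
  by move=> t _; exact: coord0_cts.
- apply: closedI; first exact: closed_cube.
  apply: (@preimage_closed _ R (fun t : 'rV[R]_n.+1 => t ord0 ord0)
    [set x | 2^-1 <= x]); last exact: closed_ge.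
  by move=> t _; exact: coord0_cts.
- apply: (@eq_within _ _
    (f \o fun t => set_coord0 t (2 * t ord0 ord0 + 0))).
    move=> t [_ /= t2].
    by rewrite /concat_fun t2 addr0.
  refine (@comp_within _ _ _ _ (fun t => set_coord0 t (2 * t ord0 ord0 + 0))
    _ _ (nloop_cts f)); first exact: set_coord0_cts.
  move=> t [ct]; rewrite /lo /= => t2 i; rewrite mxE; case: eqP => // _.
  by case/andP: (ct ord0) => ? ?; apply/andP; split; lra.
- apply: (@eq_within _ _
    (g \o fun t => set_coord0 t (2 * t ord0 ord0 - 1))).
    move=> t [ct /= t2]; rewrite /concat_fun.
    case: ifPn => // t2'.
    have -> : t ord0 ord0 = 2^-1 by apply/eqP; rewrite eq_le t2 t2'.
    rewrite !nloop_boundary//; split.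
    + by move=> i; rewrite mxE; case: eqP => // _; apply/andP; split; lra.
    + by exists ord0; right; rewrite mxE eqxx; lra.
    + by move=> i; rewrite mxE; case: eqP => // _; apply/andP; split; lra.
    + by exists ord0; left; rewrite mxE eqxx; lra.
  refine (@comp_within _ _ _ _ (fun t => set_coord0 t (2 * t ord0 ord0 - 1))
    _ _ (nloop_cts g)); first exact: set_coord0_cts.
  move=> t [ct]; rewrite /hi /= => t2 i; rewrite mxE; case: eqP => // _.
  by case/andP: (ct ord0) => ? ?; apply/andP; split; lra.
Qed.

Fact concat_boundary n (x0 : X) (f g : nloop n.+1 x0) t :
  cube_boundary n.+1 t -> concat_fun f g t = x0.
Proof.
move=> [ct [i it]]; rewrite /concat_fun; case/andP: (ct ord0) => ? ?.
case: ifPn => [t2|]; last rewrite -ltNge => t2; apply: nloop_boundary; split.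
- by move=> j; rewrite mxE; case: eqP => // _; apply/andP; split; lra.
- exists i; rewrite mxE; case: eqP => [i0|_]//; left.
  by move: it; rewrite i0 => -[->|it]; lra.
- by move=> j; rewrite mxE; case: eqP => // _; apply/andP; split; lra.
- exists i; rewrite mxE; case: eqP => [i0|_]//; right.
  by move: it; rewrite i0 => -[it|->]; lra.
Qed.

Definition concat n (x0 : X) (f g : nloop n.+1 x0) : nloop n.+1 x0 :=
  NLoop (@concat_cts n x0 f g) (@concat_boundary n x0 f g).

(* The product of pi_1 is the class of the concatenation of loops. *)
Definition pi1_isomorphic (x0 : X) (P : groupType) : Prop :=
  exists phi : homotopy_group 1 x0 -> P, bijective phi /\
    forall f g : nloop 1 x0,
      phi (hclass (concat f g)) = (phi (hclass f) * phi (hclass g))%g.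

Definition path_connected : Prop :=
  inhabited X /\
  forall x y : X, exists gamma : R -> X,
    [/\ {within `[0, 1], continuous gamma}, gamma 0 = x & gamma 1 = y].

Definition eilenberg_maclane1 (P : groupType) : Prop :=
  path_connected /\
  forall x0 : X, pi1_isomorphic x0 P /\
    forall n, (2 <= n)%N -> forall a b : homotopy_group n x0, a = b.

End Homotopy.

Arguments cube : clear implicits.
Arguments cube_boundary : clear implicits.
Arguments nloop_cts {R X n x0}.
Arguments eilenberg_maclane1 : clear implicits.

(* Main.v *)
Require Import Defs.
From HB Require Import structures.
From Stdlib Require Import Relation_Operators.
From mathcomp Require Import all_boot all_order all_algebra zify ring lra.
From mathcomp Require Import interval_inference all_classical all_reals.
From mathcomp Require Import topology normedtype convex.

Set Implicit Arguments.
Unset Strict Implicit.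
Unset Printing Implicit Defensive.

Import Order.TTheory GRing.Theory Num.Theory.
Import numFieldNormedType.Exports.

Local Open Scope classical_set_scope.
Local Open Scope ring_scope.

(** Put om(x,y,z) = [x,y,z].  In a 2-Engel group of class 3 it is an alternating
    trilinear form with central values, it vanishes on
    (x0^-1 x1, x0^-1 x2, x0^-1 x3) for every affinely nil-2 tuple, and
    om(a,b,c) <> 1 for some a, b, c.  Two elements generate a subgroup of class
    at most 2, so every triple is affinely nil-2 and the boundary of the
    tetrahedron 1, a, b, c is a sphere in E(3,G).  Its image in B(3,G) is not
    nullhomotopic, so pi_2(B(3,G)) <> 0.

    A point of E(3,G) is a step function [0,1] -> G.  For a continuous
    distribution function F on [0,1], the points for which one value g has
    F-measure > 1/2 form an open set on which the label g is locally constant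
    and equivariant.  These sets cover, so two distribution functions yield
    locally constant transition elements on B(3,G).  A nullhomotopy subdivided
    finely enough gives a G-valued 1-cocycle on the grid of a cube, hence a
    labelling of the grid by G whose labels on each small cube form an affinely
    nil-2 set.  As om(x0^-1 x1, x0^-1 x2, x0^-1 x3) is the coboundary of om, the
    sum of om over the labelled boundary of the cube vanishes; on the face
    carrying the sphere a Sperner count shows that this sum is om(a,b,c). *)

(** * Alternating trilinear forms *)

(* The trivial square-zero extension of the integers by A is a commutative ring
   whose additive group contains A: [ring] thus decides identities between
   elements of an abelian group. *)
Section SquareZero.
Context (A : zmodType).

Definition square_zero : Type := (int * A)%type.

HB.instance Definition _ := GRing.Zmodule.on square_zero.

Implicit Types u v w : square_zero.

Definition square_zero_mul u v : square_zero :=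
  (u.1 * v.1, v.2 *~ u.1 + u.2 *~ v.1).

Fact square_zero_mulA : associative square_zero_mul.
Proof.
move=> u v w; congr (_, _); rewrite /= ?mulrA//.
by rewrite !mulrzDl -!mulrzA addrA mulrC [w.1 * _]mulrC.
Qed.

Fact square_zero_mulC : commutative square_zero_mul.
Proof. by move=> u v; congr (_, _); [exact: mulrC|exact: addrC]. Qed.

Fact square_zero_mul1 : left_id ((1, 0) : square_zero) square_zero_mul.
Proof.
by case=> m x; rewrite /square_zero_mul/= mul1r mulr1z mul0rz addr0.
Qed.

Fact square_zero_mulD : left_distributive square_zero_mul +%R.
Proof.
move=> u v w; congr (_, _); rewrite /= ?mulrDl//.
by rewrite mulrzDr mulrzDl addrACA.
Qed.

Fact square_zero_1_neq0 : ((1, 0) : square_zero) != 0.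
Proof. by []. Qed.

HB.instance Definition _ := GRing.Zmodule_isComNzRing.Build square_zero
  square_zero_mulA square_zero_mulC square_zero_mul1 square_zero_mulD
  square_zero_1_neq0.

Definition in_square_zero (x : A) : square_zero := (0, x).

Fact in_square_zero_additive : {morph in_square_zero : x y / x - y}.
Proof. by move=> x y; congr (_, _). Qed.

HB.instance Definition _ :=
  GRing.isZmodMorphism.Build A square_zero in_square_zero
    in_square_zero_additive.

Lemma in_square_zero_inj : injective in_square_zero.
Proof. by move=> x y []. Qed.

End SquareZero.

Ltac abel := apply: in_square_zero_inj; ring.

Notation generated S := (smallest (@is_subgroup _) S).

Section Alternating3.
Context (G : groupType) (A : zmodType).

Record alternating3 (om : G -> G -> G -> A) := Alternating3 {
  alt3Ml : forall x x' y z, om (x * x')%g y z = om x y z + om x' y z;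
  alt3Mm : forall x y y' z, om x (y * y')%g z = om x y z + om x y' z;
  alt3Mr : forall x y z z', om x y (z * z')%g = om x y z + om x y z';
  alt3_xxy : forall x y, om x x y = 0;
  alt3_xyy : forall x y, om x y y = 0
}.

Variable om : G -> G -> G -> A.
Hypothesis alt : alternating3 om.

Lemma alt3_1l y z : om 1%g y z = 0.
Proof. by apply: (addIr (om 1%g y z)); rewrite -alt3Ml// mulg1 add0r. Qed.

Lemma alt3_1m x z : om x 1%g z = 0.
Proof. by apply: (addIr (om x 1%g z)); rewrite -alt3Mm// mulg1 add0r. Qed.

Lemma alt3_1r x y : om x y 1%g = 0.
Proof. by apply: (addIr (om x y 1%g)); rewrite -alt3Mr// mulg1 add0r. Qed.

Lemma alt3Vl x y z : om x^-1%g y z = - om x y z.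
Proof. by apply: (addIr (om x y z)); rewrite -alt3Ml// mulVg alt3_1l addNr. Qed.

Lemma alt3Vm x y z : om x y^-1%g z = - om x y z.
Proof. by apply: (addIr (om x y z)); rewrite -alt3Mm// mulVg alt3_1m addNr. Qed.

Lemma alt3Vr x y z : om x y z^-1%g = - om x y z.
Proof. by apply: (addIr (om x y z)); rewrite -alt3Mr// mulVg alt3_1r addNr. Qed.

Lemma alt3C12 x y z : om y x z = - om x y z.
Proof.
apply/eqP; rewrite -addr_eq0; apply/eqP; have := alt3_xxy alt (y * x)%g z.
by rewrite alt3Ml// !alt3Mm// !alt3_xxy// add0r addr0.
Qed.

Lemma alt3C23 x y z : om x z y = - om x y z.
Proof.
apply/eqP; rewrite -addr_eq0; apply/eqP; have := alt3_xyy alt x (z * y)%g.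
by rewrite alt3Mm// !alt3Mr// !alt3_xyy// add0r addr0.
Qed.

Lemma alt3_xyx x y : om x y x = 0.
Proof. by rewrite alt3C23 alt3_xxy// oppr0. Qed.

Lemma alt3_cycle x y z : om y z x = om x y z.
Proof. by rewrite alt3C23 alt3C12 opprK. Qed.

Lemma alt3_affine x0 x y z :
  om (x0^-1 * x)%g (x0^-1 * y)%g (x0^-1 * z)%g =
  om x y z - (om x0 x y + om x0 y z + om x0 z x).
Proof.
rewrite !(alt3Ml alt, alt3Mm alt, alt3Mr alt) !(alt3Vl, alt3Vm, alt3Vr).
rewrite !(alt3_xxy alt, alt3_xyx, alt3_xyy alt).
rewrite (alt3_cycle x0 x y) (alt3C12 x0 x z) (alt3C23 x0 z x).
by abel.
Qed.

Lemma alt3_generated (S : set G) :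
  (forall x y z, S x -> S y -> S z -> om x y z = 0) ->
  forall x y z, generated S x -> generated S y -> generated S z -> om x y z = 0.
Proof.
move=> om_S.
have om_gen y z : (forall x, S x -> om x y z = 0) ->
    generated S `<=` [set x | om x y z = 0].
  move=> omS; apply: smallest_sub => //; split=> /= [|u v u0 v0|u u0].
  - exact: alt3_1l.
  - by rewrite alt3Ml// u0 v0 addr0.
  - by rewrite alt3Vl u0 oppr0.
move=> x y z gx gy gz; apply: (om_gen _ _ _ x gx) => u Su; rewrite -alt3_cycle.
apply: (om_gen _ _ _ y gy) => v Sv; rewrite -alt3_cycle.
by apply: (om_gen _ _ _ z gz) => w Sw; exact: om_S.
Qed.

Lemma alt3_1xy (x y : G) : {in [:: 1%g; x; y] & &, forall p q r, om p q r = 0}.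
Proof.
move=> p q r; rewrite !inE => /or3P[]/eqP-> /or3P[]/eqP-> /or3P[]/eqP->;
  by rewrite ?(alt3_1l, alt3_1m, alt3_1r, alt3_xxy alt, alt3_xyx, alt3_xyy alt).
Qed.

End Alternating3.

Section Subgroups.
Context (G : groupType).

Definition centralizer (S : set G) : set G :=
  [set z | forall g, S g -> commute z g].

Lemma is_subgroup_centralizer (S : set G) : is_subgroup (centralizer S).
Proof.
split=> [g _|x y Cx Cy g Sg|x Cx g Sg]; apply: commute_sym.
- exact: commute1.
- by apply: commuteM; apply: commute_sym; [exact: Cx|exact: Cy].
- by apply: commuteV; apply: commute_sym; exact: Cx.
Qed.

Lemma is_subgroup_generated (S : set G) : is_subgroup (generated S).
Proof.
split=> [C [[]]//|x y Sx Sy C CS|x Sx C CS].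
  by have [[_ CM _] _] := CS; apply: CM; [exact: Sx|exact: Sy].
by have [[_ _ CV] _] := CS; apply: CV; exact: Sx.
Qed.

Lemma commg_lcsS (H : set G) n x y :
  lcs H n x -> H y -> lcs H n.+1 [~ x, y]%g.
Proof. by move=> Hx Hy; apply: sub_gen_smallest; exists x, y. Qed.

Lemma nilpotent_le2P (H : set G) :
  nilpotent_le 2 H <->
  forall x y z, H x -> H y -> H z -> [~ x, y, z]%g = 1%g.
Proof.
split=> [nH x y z Hx Hy Hz|comm_eq1].
  suff : lcs H 2 [~ x, y, z]%g by rewrite nH.
  by do 2 apply: commg_lcsS => //.
have lcs1_central : lcs H 1 `<=` centralizer H.
  apply: smallest_sub; first exact: is_subgroup_centralizer.
  by move=> _ [u [v [Hu Hv ->]]] w Hw; apply/commgP/eqP; exact: comm_eq1.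
apply/seteqP; split=> [|_ ->].
  apply: smallest_sub => [|_ [x [y [Hx Hy ->]]]].
    split=> // [x y -> ->|x ->]; first by rewrite /= mulg1.
    by rewrite /= invg1.
  by apply/eqP/commgP; exact: lcs1_central Hx _ Hy.
by move=> C [[]].
Qed.

End Subgroups.

Section Center.
Context (G : groupType).

Definition is_central (z : G) : bool := `[< centralizer [set: G] z >].

Lemma is_centralP (z : G) : reflect (forall g, commute z g) (is_central z).
Proof. by apply: (iffP (asboolP _)) => [zC g|zC g _]; exact: zC. Qed.

Lemma is_central1 : is_central (1 : G)%g.
Proof. by apply/asboolP; have [] := is_subgroup_centralizer [set: G]. Qed.

Lemma is_centralM (x y : G) :
  is_central x -> is_central y -> is_central (x * y)%g.
Proof.
move=> /asboolP Cx /asboolP Cy; apply/asboolP.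
by have [_ CM _] := is_subgroup_centralizer [set: G]; exact: CM.
Qed.

Lemma is_centralV (x : G) : is_central x -> is_central x^-1%g.
Proof.
move=> /asboolP Cx; apply/asboolP.
by have [_ _ CV] := is_subgroup_centralizer [set: G]; exact: CV.
Qed.

Record center := Center { center_val :> G; _ : is_central center_val }.

HB.instance Definition _ := [isSub for center_val].
HB.instance Definition _ := [Choice of center by <:].

Definition center_add (x y : center) := Center (is_centralM (valP x) (valP y)).
Definition center_opp (x : center) := Center (is_centralV (valP x)).
Definition center_zero := Center is_central1.

Fact center_addA : associative center_add.
Proof. by move=> x y z; apply: val_inj; rewrite /= mulgA. Qed.

Fact center_addC : commutative center_add.
Proof. by move=> x y; apply: val_inj; exact: (is_centralP _ (valP x)). Qed.

Fact center_add0 : left_id center_zero center_add.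
Proof. by move=> x; apply: val_inj; rewrite /= mul1g. Qed.

Fact center_addN : left_inverse center_zero center_opp center_add.
Proof. by move=> x; apply: val_inj; rewrite /= mulVg. Qed.

HB.instance Definition _ :=
  GRing.isZmodule.Build center center_addA center_addC center_add0 center_addN.

Lemma central_conjg (z g : G) : is_central z -> (z ^ g)%g = z.
Proof. by move=> /is_centralP/(_ g) zg; apply/conjg_fixP/commgP. Qed.

End Center.

Section Commutators.
Context (G : groupType).
Implicit Types u x y z : G.

Lemma commMgJ x y z : [~ x * y, z]%g = ([~ x, z] ^ y * [~ y, z])%g.
Proof. by rewrite !commgEl !conjgE !gnorm. Qed.

Lemma commgMJ x y z : [~ x, y * z]%g = ([~ x, z] * [~ x, y] ^ z)%g.
Proof. by rewrite !commgEl !conjgE !gnorm. Qed.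

Lemma conjg_mulR x y : (x ^ y)%g = (x * [~ x, y])%g.
Proof. by rewrite commgEl mulVKg. Qed.

Lemma commg_centralMl u z x : is_central z -> [~ u * z, x]%g = [~ u, x]%g.
Proof.
move=> /is_centralP zC; rewrite commMgJ.
have /commgP/eqP -> := zC x; rewrite mulg1.
by apply/conjg_fixP/commgP/commute_sym.
Qed.

End Commutators.

Section TwoEngelClassThree.
Context (G : groupType).
Hypothesis engel : two_engel G.
Hypothesis class3 : nilpotency_class 3 [set: G].

Lemma comm3_central (x y z : G) : is_central [~ x, y, z]%g.
Proof.
apply/is_centralP => w; apply/commgP/eqP; have [n3 _] := class3.
suff : lcs [set: G] 3 [~ [~ x, y, z], w]%g by rewrite n3.
by do 3 apply: commg_lcsS => //.
Qed.

Definition comm3 (x y z : G) : center G := Center (comm3_central x y z).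

Lemma commg2M (x y x' y' z : G) :
  [~ [~ x, y] * [~ x', y'], z]%g = ([~ x, y, z] * [~ x', y', z])%g.
Proof. by rewrite commMgJ central_conjg//; exact: comm3_central. Qed.

Lemma comm3_alternating : alternating3 comm3.
Proof.
have comm3C x y z := is_centralP _ (comm3_central x y z).
split=> [x x' y z|x y y' z|x y z z'|x y|x y]; apply: val_inj => /=.
- rewrite commMgJ conjg_mulR -mulgA (comm3C x y x') mulgA.
  by rewrite commg_centralMl ?commg2M//; exact: comm3_central.
- rewrite commgMJ conjg_mulR mulgA commg_centralMl ?commg2M//.
    exact: comm3C.
  exact: comm3_central.
- by rewrite commgMJ central_conjg; [exact: comm3C|exact: comm3_central].
- by rewrite commgg comm1g.
- exact: engel.
Qed.

Lemma comm3_neq0 : exists a b c : G, comm3 a b c != 0.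
Proof.
apply: contrapT => noabc; have [_ /(_ 2)] := class3.
suff n2 : nilpotent_le 2 [set: G] by move=> /(_ n2).
apply/nilpotent_le2P => x y z _ _ _; apply: contrapT => xyz.
by apply: noabc; exists x, y, z; apply/eqP => /(congr1 val).
Qed.

Lemma affinely_nil2_triple (x : {ffun 'I_3 -> G}) : affinely_nil2 G 2 x.
Proof.
pose d i := ((x ord0)^-1 * x i)%g.
pose S := [set` [:: 1%g; d (inord 1); d (inord 2)]].
exists (x ord0), (generated S); split.
- exact: is_subgroup_generated.
- apply/nilpotent_le2P => p q r Sp Sq Sr.
  apply: (congr1 val (_ : comm3 p q r = 0)).
  apply: (alt3_generated comm3_alternating) Sp Sq Sr => u v w.
  exact: (alt3_1xy comm3_alternating).
move=> i; exists (d i); last by rewrite mulVKg.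
apply: sub_gen_smallest; rewrite /S/= !inE.
case: (unliftP ord0 i) => [j ->|->]; last by rewrite /d mulVg eqxx.
by case: (unliftP ord0 j) => [k ->|->]; apply/or3P;
  [constructor 3|constructor 2]; apply/eqP; congr d; apply: val_inj;
  rewrite /= inordK// ord1.
Qed.

Lemma comm3_affinely_nil2 n (x : {ffun 'I_n.+1 -> G}) i j k l :
  affinely_nil2 G n x ->
  comm3 ((x i)^-1 * x j)%g ((x i)^-1 * x k)%g ((x i)^-1 * x l)%g = 0.
Proof.
move=> [y [H [[_ HM HV] /nilpotent_le2P nH Hx]]]; apply: val_inj => /=.
suff Hd m : H ((x i)^-1 * x m)%g by apply: nH.
have [h Hh ->] := Hx i; have [h' Hh' ->] := Hx m.
by rewrite invgM -mulgA mulKg; apply: HM => //; exact: HV.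
Qed.

End TwoEngelClassThree.

(** * The discrete Stokes formula *)

Section GridSums.
Context (A : zmodType).

Lemma sumr_nat_support (f : nat -> A) m n p q : (m <= p <= q)%N -> (q <= n)%N ->
  (forall i, (m <= i < n)%N -> ~~ (p <= i < q)%N -> f i = 0) ->
  \sum_(m <= i < n) f i = \sum_(p <= i < q) f i.
Proof.
move=> /andP[mp pq] qn f0; rewrite (big_cat_nat mp (leq_trans pq qn))/=.
rewrite (big_cat_nat pq qn)/= [X in X + _]big_nat [X in X + _]big1 => [|i ipq].
  rewrite [X in _ + (_ + X)]big_nat [X in _ + (_ + X)]big1 => [|i iqn].
    by rewrite add0r addr0.
  by apply: f0; lia.
by apply: f0; lia.
Qed.

(* Green's formula: P and Q are the values of a 1-form on the edges of the grid
   in the first and in the second direction. *)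
Lemma sum_square_boundary (P Q : nat -> nat -> A) m n : (m <= n)%N ->
  \sum_(m <= i < n) \sum_(m <= j < n)
    (P i j + Q i.+1 j - P i j.+1 - Q i j) =
  \sum_(m <= i < n) (P i m - P i n) + \sum_(m <= j < n) (Q n j - Q m j).
Proof.
move=> mn; transitivity (- (\sum_(m <= i < n) \sum_(m <= j < n)
  (P i j.+1 - P i j)) + \sum_(m <= j < n) \sum_(m <= i < n) (Q i.+1 j - Q i j)).
  rewrite [X in _ + X]exchange_big/= -sumrN -big_split/=; apply: eq_bigr => i _.
  by rewrite -sumrN -big_split/=; apply: eq_bigr => j _; abel.
rewrite -sumrN; congr (_ + _); apply: eq_bigr => i _; rewrite telescope_sumr//.
by rewrite opprB.
Qed.

End GridSums.

Section Grid.
Context (N : nat).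
Implicit Types p q : nat * nat * nat.

Definition grid_adj p q : bool :=
  [&& p.1.1 <= N, p.1.2 <= N, p.2 <= N, q.1.1 <= N, q.1.2 <= N & q.2 <= N]%N &&
  [&& p.1.1 <= q.1.1.+1, q.1.1 <= p.1.1.+1, p.1.2 <= q.1.2.+1,
      q.1.2 <= p.1.2.+1, p.2 <= q.2.+1 & q.2 <= p.2.+1]%N.

Lemma grid_adjC p q : grid_adj p q = grid_adj q p.
Proof. by rewrite /grid_adj; lia. Qed.

Lemma grid_adj_refll p q : grid_adj p q -> grid_adj p p.
Proof. by rewrite /grid_adj; lia. Qed.

Lemma grid_adj_reflr p q : grid_adj p q -> grid_adj q q.
Proof. by rewrite grid_adjC => /grid_adj_refll. Qed.

Definition truncate n p := (minn p.1.1 n, minn p.1.2 n, minn p.2 n).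

Lemma truncate0 p : truncate 0 p = (0, 0, 0)%N.
Proof. by rewrite /truncate !minn0. Qed.

Lemma truncate_id p : grid_adj p p -> truncate N p = p.
Proof.
by case: p => -[i j] k; rewrite /grid_adj/= => ?; congr (_, _, _) => /=; lia.
Qed.

Lemma grid_adj_truncate n p q :
  grid_adj p q -> grid_adj (truncate n p) (truncate n q).
Proof. by rewrite /grid_adj/=; lia. Qed.

Lemma grid_adj_truncateS n p q :
  grid_adj p q -> grid_adj (truncate n p) (truncate n.+1 q).
Proof. by rewrite /grid_adj/=; lia. Qed.

Context (G : groupType) (tau : nat * nat * nat -> nat * nat * nat -> G).

(* The integral of the cocycle tau along the path of truncations of p, which
   starts at the origin; truncations of adjacent points are adjacent. *)
Fixpoint potential n p : G :=
  if n is m.+1 then (potential m p * tau (truncate m p) (truncate n p))%g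
  else 1%g.

Hypothesis cocycle : forall p q r, grid_adj p q -> grid_adj q r ->
  grid_adj p r -> (tau p q * tau q r)%g = tau p r.

Lemma potential_truncate n p q : grid_adj p q ->
  (potential n p * tau (truncate n p) (truncate n q))%g = potential n q.
Proof.
move=> pq; have pp := grid_adj_refll pq; have qq := grid_adj_reflr pq.
elim: n => [|n IH].
  rewrite !truncate0 mul1g; apply: (mulgI (tau (0, 0, 0) (0, 0, 0))%N).
  by rewrite cocycle ?mulg1.
rewrite /= -IH -!mulgA !cocycle//;
  by [exact: grid_adj_truncate|exact: grid_adj_truncateS].
Qed.

Lemma potentialE p q : grid_adj p q ->
  ((potential N p)^-1 * potential N q)%g = tau p q.
Proof.
move=> pq; have := potential_truncate N pq; rewrite !truncate_id => [<-||].
- by rewrite mulKg.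
- exact: grid_adj_reflr pq.
- exact: grid_adj_refll pq.
Qed.

End Grid.

Section DiscreteStokes.
Context (G : groupType) (A : zmodType) (om : G -> G -> G -> A).
Hypothesis alt : alternating3 om.

Definition quad (p q r s : G) : A := om p q r + om p r s.

Lemma quad_const (p : G) : quad p p p p = 0.
Proof. by rewrite /quad (alt3_xxy alt) addr0. Qed.

Lemma quad_boundary (x p q r s : G) :
  om p q r = om x p q + om x q r + om x r p ->
  om p r s = om x p r + om x r s + om x s p ->
  quad p q r s = om x p q + om x q r - om x s r - om x p s.
Proof.
rewrite /quad => -> ->; rewrite (alt3C23 alt x p r) (alt3C23 alt x r s).
by rewrite (alt3C23 alt x p s); abel.
Qed.

Section Slabs.
Context (N : nat) (y : nat * nat * nat -> G).
Implicit Types p q r s : nat * nat * nat.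

Hypothesis flat : forall p q r s, grid_adj N p q -> grid_adj N p r ->
  grid_adj N p s ->
  om ((y p)^-1 * y q)%g ((y p)^-1 * y r)%g ((y p)^-1 * y s)%g = 0.

Let quad_flat x p q r s : grid_adj N x p -> grid_adj N x q -> grid_adj N x r ->
  grid_adj N x s -> quad (y p) (y q) (y r) (y s) =
  om (y x) (y p) (y q) + om (y x) (y q) (y r) - om (y x) (y s) (y r) -
  om (y x) (y p) (y s).
Proof.
move=> xp xq xr xs; have cocycle u v w : grid_adj N x u -> grid_adj N x v ->
    grid_adj N x w -> om (y u) (y v) (y w) =
    om (y x) (y u) (y v) + om (y x) (y v) (y w) + om (y x) (y w) (y u).
  move=> xu xv xw; apply/eqP; rewrite -subr_eq0 -alt3_affine//.
  exact/eqP/flat.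
by apply: quad_boundary; exact: cocycle.
Qed.

Let face1 i j k :=
  quad (y (i, j, k)) (y (i, j.+1, k)) (y (i, j.+1, k.+1)) (y (i, j, k.+1)).
Let face2 i j k :=
  quad (y (i, j, k)) (y (i.+1, j, k)) (y (i.+1, j, k.+1)) (y (i, j, k.+1)).
Let face3 i j k :=
  quad (y (i, j, k)) (y (i.+1, j, k)) (y (i.+1, j.+1, k)) (y (i, j.+1, k)).

Let cube_stokes i j k : (i < N)%N -> (j < N)%N -> (k < N)%N ->
  face3 i j k =
  face3 i j k.+1 +
  (face2 i j k + face1 i.+1 j k - face2 i j.+1 k - face1 i j k).
Proof.
move=> iN jN kN; rewrite /face1 /face2 /face3.
rewrite !(quad_flat (x := (i, j, k))); try by rewrite /grid_adj/=; lia.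
by abel.
Qed.

Definition slab k := \sum_(0 <= i < N) \sum_(0 <= j < N) face3 i j k.

Definition on_lid p : bool :=
  [|| p.1.1 == 0, p.1.1 == N, p.1.2 == 0, p.1.2 == N | p.2 == N]%N.

Hypothesis lid_const : forall p q, grid_adj N p q -> on_lid p -> y q = y p.

Let quad_lid p q r s : grid_adj N p q -> grid_adj N p r -> grid_adj N p s ->
  on_lid p -> quad (y p) (y q) (y r) (y s) = 0.
Proof.
move=> pq pr ps lp; rewrite (lid_const pq) ?(lid_const pr) ?(lid_const ps)//.
exact: quad_const.
Qed.

Let slab_succ k : (k < N)%N -> slab k = slab k.+1.
Proof.
move=> kN; transitivity (slab k.+1 + \sum_(0 <= i < N) \sum_(0 <= j < N)
    (face2 i j k + face1 i.+1 j k - face2 i j.+1 k - face1 i j k)).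
  rewrite -big_split/=; apply: eq_big_nat => i iN.
  by rewrite -big_split/=; apply: eq_big_nat => j jN; exact: cube_stokes.
rewrite (sum_square_boundary (fun i j => face2 i j k)
  (fun i j => face1 i j k))//.
rewrite !big_nat !big1 ?addr0// => i iN; rewrite /face1 /face2;
  by rewrite !quad_lid ?subr0// /on_lid/grid_adj/= ?eqxx ?orbT//; lia.
Qed.

Lemma bottom_slab_eq0 : slab 0 = 0.
Proof.
have slab0E k : (k <= N)%N -> slab 0 = slab k.
  by elim: k => [//|k IH kN]; exact: etrans (IH (ltnW kN)) (slab_succ kN).
rewrite (slab0E N)// /slab big_nat big1// => i iN.
rewrite big_nat big1// => j jN.
by apply: quad_lid; rewrite /on_lid/grid_adj/= ?eqxx ?orbT//; lia.
Qed.

End Slabs.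

Section Sperner.
Context (a b c : G) (l : nat -> nat -> G).

Lemma alt3_triangle :
  {in [:: a; b; c] & &, forall p q r,
    om p q r = om a p q + om a q r + om a r p}.
Proof.
have acb := alt3C23 alt a b c; have bac := alt3C12 alt a b c.
have bca : om b c a = om a b c by exact: alt3_cycle.
have cab : om c a b = om a b c by rewrite -bca; exact: alt3_cycle.
have cba : om c b a = - om a b c by rewrite (alt3C23 alt) cab.
move=> p q r; rewrite !inE => /or3P[]/eqP-> /or3P[]/eqP-> /or3P[]/eqP->;
  by rewrite ?(alt3_xxy alt, alt3_xyx alt, alt3_xyy alt)
    ?acb ?bac ?bca ?cab ?cba; abel.
Qed.

Lemma quad_1xy (x y : G) :
  {in [:: 1%g; x; y] & &, forall p q r, {in [:: 1%g; x; y], forall s,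
    quad p q r s = 0}}.
Proof.
by move=> p q r ? ? ? s ?; rewrite /quad !(@alt3_1xy _ _ _ alt x y)// addr0.
Qed.

Lemma sperner_square m n : (m <= n)%N ->
  (forall i j, (m <= i <= n)%N -> (m <= j <= n)%N -> l i j \in [:: a; b; c]) ->
  (forall i, (m <= i <= n)%N -> l i m \in [:: a; b]) ->
  (forall i, (m <= i <= n)%N -> l i n = c) ->
  (forall j, (m <= j <= n)%N -> l m j \in [:: a; c]) ->
  (forall j, (m <= j <= n)%N -> l n j \in [:: b; c]) ->
  \sum_(m <= i < n) \sum_(m <= j < n)
    quad (l i j) (l i.+1 j) (l i.+1 j.+1) (l i j.+1) = om a b c.
Proof.
move=> mn l_abc l_bottom l_top l_left l_right.
pose P i j := om a (l i j) (l i.+1 j); pose Q i j := om a (l i j) (l i j.+1).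
transitivity (\sum_(m <= i < n) \sum_(m <= j < n)
    (P i j + Q i.+1 j - P i j.+1 - Q i j)).
  apply: eq_big_nat => i imn; apply: eq_big_nat => j jmn.
  by apply: quad_boundary; apply: alt3_triangle; apply: l_abc; lia.
have om_a x : {in [:: a; x] &, forall p q, om a p q = 0}.
  by move=> p q p_ax q_ax; apply: (alt3_1xy alt (x := a) (y := x));
    rewrite inE ?p_ax ?q_ax ?inE ?eqxx ?orbT.
rewrite sum_square_boundary// [X in X + _]big_nat [X in X + _]big1 => [|i imn].
  transitivity (\sum_(m <= j < n) (om a b (l n j.+1) - om a b (l n j))).
    rewrite add0r; apply: eq_big_nat => j jmn.
    have -> : Q m j = 0 by apply: (om_a c); apply: l_left; lia.
    have := l_right j; have := l_right j.+1; rewrite /Q subr0 !inE.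
    move=> /(_ ltac:(lia))/orP[]/eqP-> /(_ ltac:(lia))/orP[]/eqP->;
      by rewrite !(alt3_xyy alt) ?subrr ?subr0 ?sub0r// (alt3C23 alt).
  rewrite telescope_sumr// l_top; last lia.
  have : l n m \in [:: a; b] by apply: l_bottom; lia.
  by rewrite !inE => /orP[]/eqP->; rewrite ?(alt3_xyx alt, alt3_xyy alt) subr0.
have -> : P i m = 0 by apply: (om_a b); apply: l_bottom; lia.
by rewrite /P !l_top ?(alt3_xyy alt) ?subrr//; lia.
Qed.

(* The middle ninth of the square subdivided into 3 M x 3 M is coloured as in
   Sperner's lemma; the collar around it may also take the colour 1. *)
Variant sperner_colour M i j : G -> Prop :=
| Colour1 of ~~ ((M <= i <= 2 * M) && (M <= j <= 2 * M))%N :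
    sperner_colour M i j 1%g
| ColourA of (i < 2 * M)%N & (j < 2 * M)%N : sperner_colour M i j a
| ColourB of (M < i)%N & (j < 2 * M)%N : sperner_colour M i j b
| ColourC of (M < j)%N : sperner_colour M i j c.

Variable M : nat.
Hypothesis colour : forall i j, (i <= 3 * M)%N -> (j <= 3 * M)%N ->
  sperner_colour M i j (l i j).

Let colour_in (s : seq G) i j : (i <= 3 * M)%N -> (j <= 3 * M)%N ->
  (~~ ((M <= i <= 2 * M) && (M <= j <= 2 * M))%N -> 1%g \in s) ->
  ((i < 2 * M)%N -> (j < 2 * M)%N -> a \in s) ->
  ((M < i)%N -> (j < 2 * M)%N -> b \in s) -> ((M < j)%N -> c \in s) ->
  l i j \in s.
Proof. by move=> iM jM s1 sa sb sc; case: (colour iM jM) => *; auto. Qed.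

Let quad_collar i j : (i < 3 * M)%N -> (j < 3 * M)%N ->
  ~~ ((M <= i < 2 * M) && (M <= j < 2 * M))%N ->
  quad (l i j) (l i.+1 j) (l i.+1 j.+1) (l i j.+1) = 0.
Proof.
move=> iM jM ij.
have [jlo|jlo] := ltnP j M.
  by apply: (@quad_1xy a b); apply: colour_in; rewrite ?inE ?eqxx ?orbT//; lia.
have [jhi|jhi] := leqP (2 * M)%N j.
  by apply: (@quad_1xy c c); apply: colour_in; rewrite ?inE ?eqxx ?orbT//; lia.
have [ilo|ilo] := ltnP i M;
  [apply: (@quad_1xy a c)|apply: (@quad_1xy b c)];
  by apply: colour_in; rewrite ?inE ?eqxx ?orbT//; lia.
Qed.

Lemma sum_quad_sperner : (0 < M)%N ->
  \sum_(0 <= i < 3 * M) \sum_(0 <= j < 3 * M)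
    quad (l i j) (l i.+1 j) (l i.+1 j.+1) (l i j.+1) = om a b c.
Proof.
move=> M_gt0.
rewrite (@sumr_nat_support _ _ _ _ M (2 * M)%N); [|lia|lia|]; last first.
  by move=> i iM iM'; rewrite big_nat big1// => j jM; apply: quad_collar; lia.
rewrite -(@sperner_square M (2 * M)%N); first last;
  try by move=> *; apply: colour_in; rewrite ?inE ?eqxx ?orbT//; lia.
- move=> i iM; apply/eqP; rewrite -mem_seq1; apply: colour_in;
    by rewrite ?inE ?eqxx//; lia.
- by lia.
apply: eq_big_nat => i iM.
rewrite (@sumr_nat_support _ _ _ _ M (2 * M)%N)//; try lia.
by move=> j jM jM'; apply: quad_collar; lia.
Qed.

End Sperner.
End DiscreteStokes.

(** * Continuity, convexity and compactness *)

Section PointSet.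
Context (T X : topologicalType).

Lemma closed_cover_continuous (I : finType) (D : I -> set T) (h : I -> T -> X)
    (f : T -> X) :
  (forall i, closed (D i)) -> (forall i, continuous (h i)) ->
  (forall i x, D i x -> f x = h i x) -> (forall x, exists i, D i x) ->
  continuous f.
Proof.
move=> clD ch fh covD; apply/continuous_closedP => C clC.
rewrite (_ : f @^-1` C = \bigcup_(i in [set: I]) (D i `&` h i @^-1` C)).
  apply: closed_bigcup => [|i _]; first exact: finite_finset.
  apply: closedI => //.
  by move: C clC; exact/continuous_closedP.
apply/seteqP; split=> [x fx|x [i _ [Dx hx]]]; last first.
  by rewrite /preimage/= (fh i).
by have [i Dx] := covD x; exists i => //; split=> //=; rewrite -(fh i).
Qed.

Lemma within_comp (T' : topologicalType) (A : set T) (B : set T')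
    (f : T' -> X) (h : T -> T') :
  continuous h -> (forall t, A t -> B (h t)) ->
  {within B, continuous f} -> {within A, continuous (f \o h)}.
Proof.
move=> ch AB /subspace_continuousP cf; apply/subspace_continuousP => t At.
apply: cvg_trans (cf _ (AB _ At)) => U /= /ch.
rewrite /= !nbhs_simpl/= /within/= => tU.
by apply: filterS tU => s hs As; apply: hs; exact: AB.
Qed.

Lemma closedX (A : set T) (B : set X) :
  closed A -> closed B -> closed (A `*` B).
Proof.
move=> clA clB; rewrite (_ : A `*` B = fst @^-1` A `&` snd @^-1` B)//.
apply: closedI; apply: preimage_closed => // z _;
  by [exact: cvg_fst|exact: cvg_snd].
Qed.

Lemma connected_constant (I : Type) (B : set T) (U : I -> set X) (h : T -> X)
    i x y :
  connected B -> {within B, continuous h} -> (forall i, open (U i)) ->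
  (forall i j z, U i z -> U j z -> i = j) ->
  (forall z, B z -> exists j, U j (h z)) ->
  B x -> B y -> U i (h x) -> U i (h y).
Proof.
move=> cB ch oU injU exU Bx By Ux.
have cA : connected (h @` B) by exact: connected_continuous_connected.
suff AU : h @` B `&` U i = h @` B.
  by have : (h @` B) (h y) by [exists y]; rewrite -AU => -[].
apply: cA.
- by exists (h x); split=> //; exists x.
- by exists (U i).
- exists (~` \bigcup_(j in [set j | j <> i]) U j).
    by apply: open_closedC; apply: bigcup_open => j _.
  apply/seteqP; split=> [_ [[z Bz <-] Uz]|_ [[z Bz <-] nU]];
      split; try by exists z.
    by move=> [j ji Uj]; apply: ji; exact: injU Uj Uz.
  have [j Uj] := exU z Bz; have [<-//|ji] := pselect (j = i).
  by exfalso; apply: nU; exists j.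
Qed.

End PointSet.

Section QuotientSpace.
Context (T : topologicalType) (r : T -> T -> Prop).

Lemma open_quotient (U : set (quotient_space r)) (V : set T) :
  open V -> (forall x, U (class_of r x) <-> V x) -> open U.
Proof.
move=> oV UV; suff VE : V = class_of r @^-1` U by rewrite VE in oV.
by apply/seteqP; split=> x /UV.
Qed.

Lemma class_of_continuous : continuous (class_of r).
Proof. exact: pi_continuous. Qed.

End QuotientSpace.

Section Convexity.
Context (R : realType).
Local Open Scope convex_scope.

Lemma convex_setP (V : lmodType R) (A : set (convex_lmodType V)) :
  convex_set A <-> forall (x y : V) (s : R), 0 <= s <= 1 -> A x -> A y ->
    A (s *: x + (1 - s) *: y).
Proof.
split=> [convA x y s /andP[s0 s1] Ax Ay|convA x y s].
  by have := convA x y (Itv01 s0 s1); rewrite !inE; exact.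
by rewrite !inE => Ax Ay; apply: convA; rewrite ?ge0 ?le1.
Qed.

Lemma convex_setI (V : lmodType R) (A B : set (convex_lmodType V)) :
  convex_set A -> convex_set B -> convex_set (A `&` B).
Proof.
by move=> convA convB x y s; rewrite !in_setI => /andP[Ax Bx] /andP[Ay By];
  rewrite convA ?convB.
Qed.

Lemma convex_set_ball (V : normedModType R) (x : V) (r : R) :
  convex_set (ball x r : set (convex_lmodType V)).
Proof.
apply/convex_setP => y z s /andP[s0 s1]; rewrite -!ball_normE/= => xy xz.
rewrite (_ : x - _ = s *: (x - y) + (1 - s) *: (x - z)); last first.
  by rewrite !scalerBr addrACA -opprD -scalerDl subrKC scale1r.
rewrite (le_lt_trans (ler_normD _ _))// !normrZ (ger0_norm s0).
rewrite ger0_norm ?subr_ge0//; set m := Num.max `|x - y| `|x - z|.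
have ym : `|x - y| <= m by rewrite le_max lexx.
have zm : `|x - z| <= m by rewrite le_max lexx orbT.
by apply: (@le_lt_trans _ _ m); [nra|rewrite gt_max xy].
Qed.

Lemma convex_set_connected (V : normedModType R) (A : set V) :
  convex_set (A : set (convex_lmodType V)) -> connected A.
Proof.
move=> /convex_setP convA.
have [->|/set0P[x Ax]] := eqVneq A set0; first exact: connected0.
pose seg y (s : R) := x + s *: (y - x).
have -> : A = \bigcup_(y in A) (seg y @` `[0, 1]).
  apply/seteqP; split=> [y Ay|_ [y Ay [s /= s01 <-]]].
    exists y => //; exists 1; first by rewrite /= in_itv/= ler01 lexx.
    by rewrite /seg scale1r subrKC.
  rewrite /seg scalerBr addrCA -{1}[x]scale1r -scalerBl; exact: convA.
apply: bigcup_connected => [|y Ay].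
  exists x => y Ay; exists 0; first by rewrite /= in_itv/= ler01 lexx.
  by rewrite /seg scale0r addr0.
apply: connected_continuous_connected; first exact: segment_connected.
apply: continuous_subspaceT => s; apply: cvgD; first exact: cvg_cst.
by apply: cvgZr_tmp; exact: cvg_id.
Qed.

End Convexity.

Lemma lebesgue_number (R : realType) (T : pseudoMetricType R)
    (X : topologicalType) (I : Type) (U : I -> set X) (K : set T) (h : T -> X) :
  compact K -> {within K, continuous h} -> (forall i, open (U i)) ->
  (forall x, exists i, U i x) ->
  exists2 e : R, 0 < e &
    forall v, K v -> exists i, forall z, K z -> ball v e z -> U i (h z).
Proof.
move=> compK /subspace_continuousP ch oU exU.
pose small e v := exists i, forall z, K z -> ball v e z -> U i (h z).
suff : \forall e \near 0^'+, K `<=` small e.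
  move=> Ksmall; near (0 : R)^'+ => e; exists e => //.
  by move=> v Kv; apply: (near Ksmall e).
apply: ((compact_near_coveringP K).1 compK) _ _ _ _ _ => v Kv.
have [i Ui] := exU (h v).
have /(ch v Kv) : nbhs (h v) (U i) by exact: open_nbhs_nbhs.
rewrite /= /within/= => /nbhs_ballP[e /= e0 vU].
exists (ball v (e / 2), [set d | d < e / 2]) => /=.
  split; first by apply: nbhsx_ballx; rewrite divr_gt0.
  by apply: nbhs_right_lt; rewrite divr_gt0.
move=> [w d] [/= vw de]; exists i => z Kz wz; apply: vU => //.
by apply: ball_split vw _; exact: le_ball (ltW de) _ wz.
Unshelve. all: by end_near.
Qed.

(** * Homotopy of loops *)

Section HomotopicEquivalence.
Context (R : realType).

Lemma affine_continuous (s r : R) : continuous (fun x : R => s * x + r).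
Proof.
move=> x; apply: (@continuousD _ R^o _ ( *%R s) (fun=> r)).
  exact: mulrl_continuous.
exact: cst_continuous.
Qed.

Lemma subl_continuous (r : R) : continuous (fun x : R => r - x).
Proof.
move=> x; apply: (@continuousB _ R^o _ (fun=> r) id).
  exact: cst_continuous.
exact: cvg_id.
Qed.

Lemma reparametrize_within (T X : topologicalType) (A : set T) (H : T * R -> X)
    (phi : R -> R) (u v : R) :
  continuous phi -> (forall x, u <= x <= v -> 0 <= phi x <= 1) ->
  {within A `*` `[0, 1], continuous H} ->
  {within A `*` `[u, v], continuous (fun z => H (z.1, phi z.2))}.
Proof.
move=> cphi phi01 cH; apply: (within_comp _ _ cH).
  move=> z; apply: (@cvg_pair _ _ _ (nbhs z) (nbhs z.1) (nbhs (phi z.2))).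
    exact: cvg_fst.
  apply: (@continuous_comp _ _ _ (@snd T R) phi z); last exact: cphi.
  exact: cvg_snd.
by move=> [t x] [/= At]; rewrite /= !in_itv/= => /phi01; split.
Qed.

Lemma concat_homotopy_within (T X : topologicalType) (A : set T)
    (H K : T * R -> X) : closed A ->
  {within A `*` `[0, 1], continuous H} ->
  {within A `*` `[0, 1], continuous K} ->
  (forall t, A t -> H (t, 1) = K (t, 0)) ->
  {within A `*` `[0, 1], continuous (fun z =>
    if z.2 <= 2^-1 then H (z.1, 2 * z.2) else K (z.1, 2 * z.2 - 1))}.
Proof.
move=> clA cH cK HK.
rewrite (_ : A `*` _ = (A `*` `[0, 2^-1]) `|` (A `*` `[2^-1, 1])); last first.
  apply/seteqP; split=> -[t s] /=; rewrite !in_itv/=.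
    move=> [At /andP[s0 s1]]; case: (leP s 2^-1) => [s2|/ltW s2]; [left|right];
      by split=> //; apply/andP; split.
  by move=> [|] [At /andP[? ?]]; split=> //; apply/andP; split; lra.
apply: withinU_continuous.
- by apply: closedX => //; exact: itv_closed.
- by apply: closedX => //; exact: itv_closed.
- apply: eq_within (reparametrize_within (phi := *%R 2) _ _ cH) => [[t s]||x].
  + by move=> [_ /=]; rewrite in_itv/= => /andP[_ ->].
  + exact: mulrl_continuous.
  + by move=> /andP[? ?]; apply/andP; split; lra.
- apply: eq_within
    (reparametrize_within (phi := fun x => 2 * x - 1) _ _ cK) => [[t s]||x].
  + move=> [/= At]; rewrite in_itv/= => /andP[s2 s1]; case: ifPn => // s2'.
    have -> : s = 2^-1 by lra.
    by rewrite mulfV// subrr HK.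
  + exact: affine_continuous.
  + by move=> /andP[? ?]; apply/andP; split; lra.
Qed.

Context (X : topologicalType) (n : nat) (x0 : X).
Implicit Types f g : nloop R n x0.

Lemma homotopic_refl f : homotopic f f.
Proof.
exists (f \o fst); split=> // [|t s bt _]; last exact: nloop_boundary.
by apply: (within_comp _ _ (nloop_cts f)) => [z|z []//]; exact: cvg_fst.
Qed.

Lemma homotopic_sym f g : homotopic f g -> homotopic g f.
Proof.
move=> [H [cH H_f H_g H_bd]]; exists (fun z => H (z.1, 1 - z.2)); split.
- apply: (reparametrize_within (phi := fun x => 1 - x)) cH => [|s /andP[s0 s1]].
    exact: subl_continuous.
  by apply/andP; split; lra.
- by move=> t ct /=; rewrite subr0 H_g.
- by move=> t ct /=; rewrite subrr H_f.
- by move=> t s bt /andP[s0 s1] /=; apply: H_bd => //; apply/andP; split; lra.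
Qed.

Lemma homotopic_trans f g h : homotopic f g -> homotopic g h -> homotopic f h.
Proof.
move=> [H [cH H_f H_g H_bd]] [K [cK K_g K_h K_bd]]; eexists; split.
- apply: concat_homotopy_within cH cK _; first exact: closed_cube.
  by move=> t ct; rewrite H_g// K_g.
- by move=> t ct /=; rewrite invr_ge0 ler0n mulr0 H_f.
- move=> t ct /=; rewrite ifN; last by rewrite -ltNge; lra.
  by rewrite (_ : 2 * 1 - 1 = 1) ?K_h//; lra.
- move=> t s bt /andP[s0 s1] /=; case: ifPn => [s2|]; last rewrite -ltNge => s2.
    by apply: H_bd => //; apply/andP; split; lra.
  by apply: K_bd => //; apply/andP; split; lra.
Qed.

Lemma hclass_homotopic f g : hclass f = hclass g -> homotopic f g.
Proof.
have fgP := @eqmodP {classic nloop R n x0}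
  (equiv_gen_equiv (@homotopic R X n x0)) f g.
move=> /fgP/asboolP; elim=> [//|h|h k _|h k l _ + _].
- exact: homotopic_refl.
- exact: homotopic_sym.
- exact: homotopic_trans.
Qed.

End HomotopicEquivalence.

(** * Points of the standard simplex *)

Section SimplexPoints.
Context (R : realType).

Lemma row_continuous (T : topologicalType) n (h : T -> 'rV[R]_n) :
  (forall j, continuous (fun z => h z ord0 j)) -> continuous h.
Proof.
move=> ch z U /= [P /= Pnbhs PU].
suff : \forall s \near z, forall i j, P i j (h s i j).
  by apply: filterS => s; exact: PU.
apply: filter_forall => i; apply: filter_forall => j.
by rewrite (ord1 i); exact: (ch j z _ (Pnbhs ord0 j)).
Qed.

Lemma simplex_coord_ge0 n (t : std_simplex R n) i : 0 <= val t ord0 i.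
Proof. by have [] := set_mem (valP t). Qed.

Lemma sum_simplex_coord n (t : std_simplex R n) : \sum_i val t ord0 i = 1.
Proof. by have [] := set_mem (valP t). Qed.

Lemma simplex_coord_continuous n i :
  continuous (fun t : std_simplex R n => val t ord0 i).
Proof.
move=> t; apply: (@continuous_comp _ _ _ (val : std_simplex R n -> 'rV[R]_n.+1)
  (fun v => v ord0 i)); last exact: coord_continuous.
exact: initial_continuous.
Qed.

Lemma push_continuous m n (f : 'I_m.+1 -> 'I_n.+1) : continuous (@push R _ _ f).
Proof.
apply: continuous_comp_initial; apply: row_continuous => j t.
rewrite /continuous_at/=; under eq_cvg do rewrite mxE; rewrite mxE.
apply: continuous_big => [|k _]; first exact: add_continuous.
exact: simplex_coord_continuous.
Qed.

Lemma push_comp l m n (f : 'I_m.+1 -> 'I_n.+1) (g : 'I_l.+1 -> 'I_m.+1)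
    (t : std_simplex R l) : push f (push g t) = push (f \o g) t.
Proof.
apply/val_inj/rowP => j.
rewrite !mxE [RHS](partition_big g (fun i => f i == j))//=.
apply: eq_bigr => i fi; rewrite mxE; apply: eq_bigl => k.
by case: eqP => [->|]; rewrite ?fi ?andbF.
Qed.

Lemma eq_push m n (f g : 'I_m.+1 -> 'I_n.+1) (t : std_simplex R m) :
  f =1 g -> push f t = push g t.
Proof.
move=> fg; apply/val_inj/rowP => j; rewrite !mxE.
by apply: eq_bigl => k; rewrite fg.
Qed.

Lemma push_coord_inj m n (f : 'I_m.+1 -> 'I_n.+1) (t : std_simplex R m) i :
  injective f -> val (push f t) ord0 (f i) = val t ord0 i.
Proof.
by move=> injf; rewrite mxE (big_pred1 i)// => k; rewrite (inj_eq injf).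
Qed.

Lemma push_inj m n (f : 'I_m.+1 -> 'I_n.+1) :
  injective f -> injective (@push R _ _ f).
Proof.
move=> injf s t st; apply/val_inj/rowP => i.
by rewrite -!(push_coord_inj _ _ injf) st.
Qed.

Lemma push_support_id n (f : 'I_n.+1 -> 'I_n.+1) (t : std_simplex R n) :
  (forall i, val t ord0 i != 0 -> f i = i) -> push f t = t.
Proof.
move=> fid; apply/val_inj/rowP => j; rewrite mxE -[RHS](big_pred1_eq +%R j).
rewrite [LHS]big_mkcond [RHS]big_mkcond; apply: eq_bigr => k _.
by have [->|/fid->//] := eqVneq (val t ord0 k) 0; rewrite !if_same.
Qed.

(* The left inverse of [lift i] sending i to 0: on the facet opposite to the
   vertex i, pushing forward along it drops the coordinate i. *)
Definition collapse n (i j : 'I_n.+2) : 'I_n.+1 := odflt ord0 (unlift i j).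

Lemma push_lift_collapse n (i : 'I_n.+2) (t : std_simplex R n.+1) :
  val t ord0 i = 0 -> push (lift i) (push (collapse i) t) = t.
Proof.
move=> ti; rewrite push_comp; apply: push_support_id => j tj.
rewrite /= /collapse; case: unliftP => [j' -> //|ji].
by rewrite ji ti eqxx in tj.
Qed.

Lemma push_collapse_coord n (i : 'I_n.+2) j (t : std_simplex R n.+1) :
  val t ord0 i = 0 -> val (push (collapse i) t) ord0 j = val t ord0 (lift i j).
Proof.
by move=> /push_lift_collapse {2}<-; rewrite push_coord_inj//; exact: lift_inj.
Qed.

End SimplexPoints.

(** * Maps from the boundary of a simplex *)

Section BoundaryPoint.
Context (R : realType) (X : simplicialSet).

Lemma rpoint_face n (i : 'I_n.+2) (x : X n.+1) (t : std_simplex R n) :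
  rpoint x (push (lift i) t) = rpoint (face i x) t.
Proof. by apply/esym/class_ofP/rst_step; exact: glue_face. Qed.

Lemma rpoint_continuous n (x : X n) : continuous (@rpoint R X n x).
Proof.
move=> t; apply: (@continuous_comp _ _ _ (cell x) (class_of (@Defs.glue R X))).
  exact: existT_continuous.
exact: class_of_continuous.
Qed.

Context (n : nat) (x : 'I_n.+3 -> X n.+1).
Hypothesis face_compatible : forall (i j : 'I_n.+3) (i' j' : 'I_n.+2),
  j = lift i j' -> i = lift j i' -> face j' (x i) = face i' (x j).

(* Off the boundary of the simplex this is a junk value. *)
Definition boundary_point (t : std_simplex R n.+2) : realization R X :=
  let i := odflt ord0 [pick i | val t ord0 i == 0] in
  rpoint (x i) (push (collapse i) t).

Lemma rpoint_facets i j (t : std_simplex R n.+2) :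
  val t ord0 i = 0 -> val t ord0 j = 0 ->
  rpoint (x i) (push (collapse i) t) = rpoint (x j) (push (collapse j) t).
Proof.
have [->//|ij] := eqVneq i j; move=> ti tj.
have [j' jE _] := unlift_some ij.
have [i' iE _] : {i' | i = lift j i' & unlift j i = Some i'}.
  by apply: unlift_some; rewrite eq_sym.
set u := push (collapse i) t; set v := push (collapse j) t.
have uE : push (lift j') (push (collapse j') u) = u.
  by apply: push_lift_collapse; rewrite push_collapse_coord// -jE.
have vE : push (lift i') (push (collapse i') v) = v.
  by apply: push_lift_collapse; rewrite push_collapse_coord// -iE.
rewrite -uE -vE !rpoint_face (face_compatible jE iE); congr rpoint.
have liftC : lift i \o lift j' =1 lift j \o lift i'.
  move=> k; apply/val_inj; move: (congr1 val jE) (congr1 val iE) => /=.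
  by rewrite /bump; lia.
apply: (push_inj (inj_comp (@lift_inj _ j) (@lift_inj _ i'))).
by rewrite -(eq_push _ liftC) -!push_comp uE vE !push_lift_collapse.
Qed.

Lemma boundary_pointE i (t : std_simplex R n.+2) : val t ord0 i = 0 ->
  boundary_point t = rpoint (x i) (push (collapse i) t).
Proof.
rewrite /boundary_point => ti; case: pickP => [j /eqP tj|/(_ i)].
  exact: rpoint_facets.
by rewrite ti eqxx.
Qed.

Lemma boundary_point_continuous (T : topologicalType)
    (h : T -> std_simplex R n.+2) :
  continuous h -> (forall z, exists i, val (h z) ord0 i = 0) ->
  continuous (boundary_point \o h).
Proof.
move=> ch h0; apply: (@closed_cover_continuous _ _ _
  (fun i => [set z | val (h z) ord0 i = 0])
  (fun i z => rpoint (x i) (push (collapse i) (h z)))) => //.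
- move=> i; apply: (@preimage_closed _ R (fun z => val (h z) ord0 i)
    [set y | y = 0]); last exact: closed_eq.
  move=> z _.
  apply: (@continuous_comp _ _ _ h (fun t => val t ord0 i) z (ch z)).
  exact: simplex_coord_continuous.
- move=> i z; apply: (@continuous_comp _ _ _ h
    (fun t => rpoint (x i) (push (collapse i) t)) z (ch z)).
  apply: (@continuous_comp _ _ _ (push (collapse i)) (@rpoint R X _ (x i))).
    exact: push_continuous.
  exact: rpoint_continuous.
- by move=> i z; exact: boundary_pointE.
Qed.

End BoundaryPoint.

(** * The mass of a label *)

Section Clamp.
Context (R : realType).

Definition clamp (z : R) : R := Num.max 0 (Num.min 1 z).

Lemma clamp_itv z : 0 <= clamp z <= 1.
Proof. by rewrite /clamp le_max lexx ge_max ler01 ge_min lexx. Qed.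

Lemma clamp_le0 z : z <= 0 -> clamp z = 0.
Proof. by move=> z0; rewrite /clamp max_l// ge_min z0 orbT. Qed.

Lemma clamp_ge1 z : 1 <= z -> clamp z = 1.
Proof. by move=> z1; rewrite /clamp min_l// max_r. Qed.

Lemma clamp_homo : {homo clamp : x y / x <= y}.
Proof.
move=> x y xy.
by rewrite /clamp ge_max !le_max lexx/= le_min !ge_min lexx xy !orbT.
Qed.

Lemma clamp_continuous : continuous clamp.
Proof.
move=> z; apply: (@continuous_max R R (fun=> 0) (Num.min 1)).
  exact: cvg_cst.
by apply: (@continuous_min R R (fun=> 1) id); [exact: cvg_cst|exact: cvg_id].
Qed.

End Clamp.

Section Mass.
Context (R : realType) (G : groupType).
Implicit Types (F : R -> R) (g h : G).

Definition cdf F : Prop :=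
  [/\ continuous F, {homo F : x y / x <= y}, F 0 = 0 & F 1 = 1].

(* The points psum t 0 <= ... <= psum t n.+1 subdivide [0, 1] into intervals of
   lengths the barycentric coordinates of t. *)
Definition psum n (t : std_simplex R n) (j : nat) : R :=
  \sum_(k < n.+1 | (k < j)%N) val t ord0 k.

Lemma psum0 n (t : std_simplex R n) : psum t 0 = 0.
Proof. by rewrite /psum big_pred0. Qed.

Lemma psumn n (t : std_simplex R n) : psum t n.+1 = 1.
Proof.
by rewrite -(sum_simplex_coord t); apply: eq_bigl => k; rewrite ltn_ord.
Qed.

Lemma psumS n (t : std_simplex R n) (i : 'I_n.+1) :
  psum t i.+1 = psum t i + val t ord0 i.
Proof.
rewrite /psum (bigD1 i)/= ?ltnSn// addrC; congr (_ + _).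
by apply: eq_bigl => k; rewrite ltnS ltn_neqAle andbC.
Qed.

Lemma psum_homo n (t : std_simplex R n) (i : 'I_n.+1) : psum t i <= psum t i.+1.
Proof. by rewrite psumS lerDl simplex_coord_ge0. Qed.

Lemma psum_ge0 n (t : std_simplex R n) i : 0 <= psum t i.
Proof. by apply: sumr_ge0 => k _; exact: simplex_coord_ge0. Qed.

Lemma psum_le1 n (t : std_simplex R n) i : psum t i <= 1.
Proof.
rewrite -(sum_simplex_coord t) [leRHS](bigID (fun k : 'I_n.+1 => (k < i)%N))/=.
by rewrite lerDl sumr_ge0// => k _; exact: simplex_coord_ge0.
Qed.

Lemma psum_continuous n j : continuous (fun t : std_simplex R n => psum t j).
Proof.
apply: continuous_big => [|k _]; first exact: add_continuous.
exact: simplex_coord_continuous.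
Qed.

Lemma psum_push m n (f : 'I_m.+1 -> 'I_n.+1) (t : std_simplex R m) j :
  psum (push f t) j = \sum_(k | (f k < j)%N) val t ord0 k.
Proof.
rewrite /psum (partition_big f (fun j' : 'I_n.+1 => (j' < j)%N))//=.
apply: eq_bigr => j' j'j; rewrite mxE; apply: eq_bigl => k.
by case: eqP => [->|]; rewrite ?j'j ?andbF.
Qed.

Definition mass F g n (x : {ffun 'I_n.+1 -> G}) (t : std_simplex R n) : R :=
  \sum_(i | x i == g) (F (psum t i.+1) - F (psum t i)).

Lemma mass_continuous F g n (x : {ffun 'I_n.+1 -> G}) : continuous F ->
  continuous (mass F g x : std_simplex R n -> R).
Proof.
move=> cF; apply: continuous_big => [|k _]; first exact: add_continuous.
move=> t; apply: (@continuousB _ R^o _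
    (fun t : std_simplex R n => F (psum t k.+1)) (fun t => F (psum t k)));
  by apply: continuous_comp; [exact: psum_continuous|exact: cF].
Qed.

Lemma down_closed_ltn n (P : pred 'I_n) :
  (forall i j : 'I_n, (i <= j)%N -> P j -> P i) ->
  exists2 c, (c <= n)%N & forall k : 'I_n, P k = (k < c)%N.
Proof.
move=> downP.
have [[k0 nk0]|/forallNP allP] := pselect (exists k, ~~ P k); last first.
  by exists n => // k; rewrite ltn_ord; have /negP/negPn := allP k.
have [c nc cmin] := @arg_minnP _ k0 (fun k => ~~ P k) val nk0.
exists c => [|k]; first exact/ltnW.
apply/idP/idP => [Pk|]; last by apply: contraTT => /cmin; rewrite -leqNgt.
by rewrite ltnNge; apply: contra nc => /downP; apply.
Qed.

Lemma sum_ord_telescope n (u : nat -> R) c : (c <= n)%N ->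
  \sum_(k < n | (k < c)%N) (u k.+1 - u k) = u c - u 0%N.
Proof.
move=> cn; rewrite -(big_ord_widen _ (fun k => u k.+1 - u k) cn).
by rewrite -(big_mkord xpredT (fun k => u k.+1 - u k)) telescope_sumr.
Qed.

Lemma sum_cdf_push F m n (f : 'I_m.+1 -> 'I_n.+1) (t : std_simplex R m) j :
  {homo f : i j / (i <= j)%N} ->
  \sum_(k | (f k < j)%N) (F (psum t k.+1) - F (psum t k)) =
  F (psum (push f t) j) - F 0.
Proof.
move=> homo_f; have [|c cm fc] := @down_closed_ltn _ (fun k => (f k < j)%N).
  by move=> k k' /homo_f; exact: leq_ltn_trans.
rewrite (eq_bigl _ _ fc) (sum_ord_telescope (fun k => F (psum t k)))// psum0.
by rewrite psum_push (eq_bigl _ _ fc).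
Qed.

Lemma mass_reindex F g m n (f : 'I_m.+1 -> 'I_n.+1) (x : {ffun 'I_n.+1 -> G})
    (t : std_simplex R m) : {homo f : i j / (i <= j)%N} ->
  mass F g [ffun i => x (f i)] t = mass F g x (push f t).
Proof.
move=> homo_f; rewrite /mass.
rewrite (partition_big f (fun j : 'I_n.+1 => x j == g))/=; last first.
  by move=> i; rewrite ffunE.
apply: eq_bigr => j xj; pose d k := F (psum t k.+1) - F (psum t k).
transitivity (\sum_(k | (f k < j.+1)%N) d k - \sum_(k | (f k < j)%N) d k);
  last by rewrite !sum_cdf_push//; lra.
apply/esym/eqP; rewrite subr_eq; apply/eqP.
rewrite (bigID (fun k => (f k < j)%N))/= addrC.
congr (_ + _); apply: eq_bigl => k.
  rewrite ffunE -leqNgt ltnS -eqn_leq; case: (eqVneq (f k) j) => [->|fkj].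
    by rewrite eqxx xj.
  by rewrite andbF; apply/negP => /eqP/val_inj/eqP; apply/negP.
by case: (ltnP (f k) j) => [/ltnW fkj|]; rewrite ?andbT ?andbF// ltnS.
Qed.

Section MassOfPoint.
Context (F : R -> R) (n : nat) (x : {ffun 'I_n.+1 -> G}) (t : std_simplex R n).
Hypothesis F_cdf : cdf F.

Let d (i : 'I_n.+1) := F (psum t i.+1) - F (psum t i).

Let d_ge0 i : 0 <= d i.
Proof. by rewrite subr_ge0; have [_ mF _ _] := F_cdf; exact/mF/psum_homo. Qed.

Let sum_d : \sum_i d i = 1.
Proof.
have [_ _ F0 F1] := F_cdf.
have := sum_ord_telescope (fun k => F (psum t k)) (leqnn n.+1).
rewrite psumn psum0 F0 F1 subr0 => <-.
by apply: eq_bigl => k; rewrite ltn_ord.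
Qed.

Lemma mass_unique g h : 2^-1 < mass F g x t -> 2^-1 < mass F h x t -> g = h.
Proof.
move=> xg xh; apply/eqP/negPn/negP => gh.
suff : mass F g x t + mass F h x t <= 1 by lra.
rewrite /mass [X in X + _]big_mkcond [X in _ + X]big_mkcond -big_split/= -sum_d.
apply: ler_sum => i _.
have [xig|xig] := eqVneq (x i) g; have [xih|xih] := eqVneq (x i) h.
- by rewrite -xig -xih eqxx in gh.
- by rewrite addr0.
- by rewrite add0r.
- by rewrite addr0; exact: d_ge0.
Qed.

Lemma mass_ge g i : x i = g -> d i <= mass F g x t.
Proof.
move=> xi; rewrite /mass (bigD1 i) ?xi//= lerDl.
by apply: sumr_ge0 => k _; exact: d_ge0.
Qed.

End MassOfPoint.

Lemma mass_support F g n (x : {ffun 'I_n.+1 -> G}) (t : std_simplex R n) :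
  2^-1 < mass F g x t -> exists i, x i = g /\ val t ord0 i != 0.
Proof.
move=> xg; apply: contrapT => noi; move: xg; rewrite /mass big1 => [|i /eqP xi].
  by rewrite ltNge invr_ge0 ler0n.
rewrite psumS; suff -> : val t ord0 i = 0 by rewrite addr0 subrr.
by apply/eqP; apply: contrapT => /negP ti; apply: noi; exists i.
Qed.

(* F may put all its mass on one interval of positive length. *)
Lemma mass_exists n (x : {ffun 'I_n.+1 -> G}) (t : std_simplex R n) :
  exists F g, cdf F /\ 2^-1 < mass F g x t.
Proof.
have [i ti] : exists i, 0 < val t ord0 i.
  apply: contrapT => noi; have := sum_simplex_coord t.
  rewrite big1 => [/eqP|i _]; first by rewrite eq_sym oner_eq0.
  apply/eqP; rewrite eq_le simplex_coord_ge0 andbT leNgt.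
  by apply/negP => ti; apply: noi; exists i.
set w := val t ord0 i in ti; have w0 : w != 0 by rewrite gt_eqF.
pose F z := clamp (w^-1 * z - w^-1 * psum t i).
have F_cdf : cdf F.
  split.
  - move=> z; apply: (@continuous_comp _ _ _
      (fun z => w^-1 * z - w^-1 * psum t i) (@clamp R)).
      exact: affine_continuous.
    exact: clamp_continuous.
  - by move=> y z yz; apply: clamp_homo; rewrite lerD2r ler_pM2l// invr_gt0.
  - rewrite /F mulr0 add0r clamp_le0// oppr_le0 mulr_ge0 ?psum_ge0//.
    by rewrite invr_ge0 ltW.
  - rewrite /F -mulrBr clamp_ge1// -[leLHS](mulVf w0).
    by rewrite ler_pM2l ?invr_gt0// lerBrDl -psumS psum_le1.
exists F, (x i); split=> //; apply: lt_le_trans (mass_ge t F_cdf (erefl (x i))).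
rewrite /F psumS -/w -!mulrBr [psum t i + w]addrC addrK mulVf// subrr mulr0.
by rewrite (clamp_le0 (lexx 0)) clamp_ge1//; lra.
Qed.

End Mass.

(** * Labels on E(3,G) and transitions on B(3,G) *)

Section Labels.
Context (R : realType) (G : groupType).
Implicit Types (F : R -> R) (g h : G).

Definition cell_mass F g (c : cells R (E3_sset G)) : R :=
  mass F g (val (tagged (tag c) : affinely_nil2 G _)) (tagged c).

Lemma cell_mass_glue F g c d :
  Defs.glue c d -> cell_mass F g c = cell_mass F g d.
Proof.
case=> [n i x t|n i x t]; rewrite /cell_mass /=; apply: mass_reindex => j k.
  by rewrite /= /bump; lia.
by rewrite /= /unbump; lia.
Qed.

Definition E3_mass F g (p : E3 G R) : R := cell_mass F g (rep_of p).

Lemma E3_mass_class F g (c : cells R (E3_sset G)) :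
  E3_mass F g (class_of (@Defs.glue R _) c) = cell_mass F g c.
Proof.
have /class_ofP : class_of (@Defs.glue R (E3_sset G))
    (rep_of (class_of (@Defs.glue R _) c)) =
  class_of (@Defs.glue R _) c by rewrite rep_ofK.
rewrite /E3_mass; move: (rep_of _) => d.
by elim=> {c d} [? ? /cell_mass_glue//|//|? ? _ ->//|? ? ? _ -> _ ->//].
Qed.

Lemma E3_mass_rpoint F g n (x : affinely_nil2 G n) (t : std_simplex R n) :
  E3_mass F g (rpoint (x : E3_sset G n) t) = mass F g (val x) t.
Proof. exact: E3_mass_class. Qed.

Lemma E3_ind (Q : E3 G R -> Prop) :
  (forall n (x : affinely_nil2 G n) t, Q (rpoint (x : E3_sset G n) t)) ->
  forall p, Q p.
Proof.
move=> Qr p; rewrite -(rep_ofK p); case: (rep_of p) => -[n x] t; exact: Qr.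
Qed.

Definition label F g (p : E3 G R) : Prop := 2^-1 < E3_mass F g p.

Lemma open_label F g : cdf F -> open (label F g).
Proof.
move=> [cF _ _ _].
apply: (@open_quotient _ (@Defs.glue R (E3_sset G)) _
  [set c | 2^-1 < cell_mass F g c]).
  apply/sigT_openP => -[n x].
  apply: (@open_comp (std_simplex R n) R
    (mass F g (val (x : affinely_nil2 G n))) [set z : R | 2^-1 < z]).
    by move=> t _; exact: mass_continuous.
  exact: open_gt.
by move=> c; rewrite /label E3_mass_class.
Qed.

Lemma label_unique F g h p : cdf F -> label F g p -> label F h p -> g = h.
Proof. by move=> F_cdf; exact: mass_unique. Qed.

Lemma label_exists p : exists F g, cdf F /\ label F g p.
Proof. exact: mass_exists. Qed.

Lemma label_support F g n (x : affinely_nil2 G n) (t : std_simplex R n) :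
  label F g (rpoint (x : E3_sset G n) t) ->
  exists i, val x i = g /\ val t ord0 i != 0.
Proof. by rewrite /label E3_mass_rpoint; exact: mass_support. Qed.

Lemma label_act F g h p : label F (h * g)%g (E3_act h p) <-> label F g p.
Proof.
elim/E3_ind: p => n x t; rewrite /E3_act realization_mapE /label.
rewrite (@E3_mass_rpoint F _ _ (translate h x)) E3_mass_rpoint.
suff -> : mass F (h * g)%g (val (translate h x)) t = mass F g (val x) t by [].
by apply: eq_bigl => i; rewrite /= ffunE (inj_eq (mulgI h)).
Qed.

Definition transition F F' g (b : B3 G R) : Prop :=
  exists h, label F h (rep_of b) /\ label F' (h * g)%g (rep_of b).

Definition labelled F : set (B3 G R) := transition F F 1%g.

Lemma transition_class F F' g (p : E3 G R) :
  transition F F' g (class_of (@E3_orbit G R) p) <->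
  exists h, label F h p /\ label F' (h * g)%g p.
Proof.
have /class_ofP : class_of (@E3_orbit G R)
    (rep_of (class_of (@E3_orbit G R) p)) =
  class_of (@E3_orbit G R) p by rewrite rep_ofK.
rewrite /transition; move: (rep_of _) => q.
elim=> {p q} [p _ [k ->]|//|? ? _ IH|? ? ? _ IH1 _ IH2].
- split=> -[h [lh lh']].
    by exists (k * h)%g; rewrite -mulgA; split; apply/label_act.
  by exists (k^-1 * h)%g; rewrite -mulgA; split; apply/(label_act _ _ k);
    rewrite mulVKg.
- exact: iff_sym.
- exact: iff_trans IH1 IH2.
Qed.

Lemma labelled_class F (p : E3 G R) :
  labelled F (class_of (@E3_orbit G R) p) <-> exists h, label F h p.
Proof.
split=> [/transition_class[h [lh _]]|[h lh]]; first by exists h.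
by apply/transition_class; exists h; rewrite mulg1.
Qed.

(* Inferring implicit arguments would unfold [open] in the iterated quotient. *)
Unset Implicit Arguments.

Lemma open_transition F F' g : cdf F -> cdf F' -> open (transition F F' g).
Proof.
move=> F_cdf F'_cdf; apply: (@open_quotient _ (@E3_orbit G R) _
  (\bigcup_h (label F h `&` label F' (h * g)%g))).
  by apply: bigcup_open => h _; apply: openI; exact: open_label.
move=> p; split=> [/transition_class[h ?]|[h _ ?]]; first by exists h.
by apply/transition_class; exists h.
Qed.

Set Implicit Arguments.

Lemma transition_unique F F' g g' b : cdf F -> cdf F' ->
  transition F F' g b -> transition F F' g' b -> g = g'.
Proof.
move=> F_cdf F'_cdf [h [lh lh']] [k [lk lk']].
have hk := label_unique F_cdf lh lk; rewrite -hk in lk'.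
exact/(mulgI h)/(label_unique F'_cdf lh' lk').
Qed.

Lemma transition_comp F F' F'' g g' b : cdf F' ->
  transition F F' g b -> transition F' F'' g' b ->
  transition F F'' (g * g')%g b.
Proof.
move=> F'_cdf [h [lh lh']] [k [lk lk']]; exists h; split=> //.
by rewrite mulgA (label_unique F'_cdf lh' lk).
Qed.

Lemma transition_exists F F' b : labelled F b -> labelled F' b ->
  exists g, transition F F' g b.
Proof.
by move=> [h [lh _]] [k [lk _]]; exists (h^-1 * k)%g, h; rewrite mulVKg.
Qed.

Lemma labelled_exists b : exists F, cdf F /\ labelled F b.
Proof.
have [F [g [F_cdf lg]]] := label_exists (rep_of b).
by exists F; split=> //; exists g; rewrite mulg1.
Qed.

Lemma transition_flat (A : zmodType) (om : G -> G -> G -> A)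
    F F1 F2 F3 g1 g2 g3 b :
  (forall n (x : {ffun 'I_n.+1 -> G}) i j k l, affinely_nil2 G n x ->
     om ((x i)^-1 * x j)%g ((x i)^-1 * x k)%g ((x i)^-1 * x l)%g = 0) ->
  cdf F -> transition F F1 g1 b -> transition F F2 g2 b ->
  transition F F3 g3 b -> om g1 g2 g3 = 0.
Proof.
move=> flat F_cdf [h [lh l1]] [h' [lh' l2]] [h'' [lh'' l3]].
rewrite -(label_unique F_cdf lh lh') in l2.
rewrite -(label_unique F_cdf lh lh'') in l3.
move: (rep_of b) lh l1 l2 l3 {lh' lh''}; elim/E3_ind=> n x t.
move=> /label_support[i [xi _]] /label_support[j [xj _]].
move=> /label_support[k [xk _]] /label_support[l [xl _]].
have gE g y : (h * g)%g = y -> g = (h^-1 * y)%g by move=> <-; rewrite mulKg.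
rewrite (gE _ _ (esym xj)) (gE _ _ (esym xk)) (gE _ _ (esym xl)) -xi.
exact/flat/set_mem/(valP x).
Qed.

End Labels.

(** * The tetrahedral sphere *)

Section FacetPoint.
Context (R : realType) (G : groupType) (n : nat) (v : {ffun 'I_n.+3 -> G}).
Hypothesis nil2_facet : forall i : 'I_n.+3,
  affinely_nil2 G n.+1 [ffun j => v (lift i j)].

Definition facet (i : 'I_n.+3) : E3_sset G n.+1 :=
  exist (fun u => u \in affinely_nil2 G n.+1) _ (mem_set (nil2_facet i)).

Lemma facet_compatible (i j : 'I_n.+3) (i' j' : 'I_n.+2) :
  j = lift i j' -> i = lift j i' -> face j' (facet i) = face i' (facet j).
Proof.
move=> jE iE; apply/val_inj/ffunP => k; rewrite !ffunE; congr (v _).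
apply/val_inj; move: (congr1 val jE) (congr1 val iE) => /=.
by rewrite /bump; lia.
Qed.

Definition facet_point (t : std_simplex R n.+2) : E3 G R :=
  boundary_point facet t.

Lemma label_facet_point F g (t : std_simplex R n.+2) i : val t ord0 i = 0 ->
  label F g (facet_point t) -> exists j, v j = g /\ val t ord0 j != 0.
Proof.
move=> ti; rewrite /facet_point (boundary_pointE facet_compatible ti).
move=> /label_support[j [<- tj]]; exists (lift i j); rewrite ffunE.
by rewrite -push_collapse_coord.
Qed.

End FacetPoint.

Section Sphere.
Context (R : realType).
Implicit Types (s : R) (z : 'rV[R]_2).

Definition ramp s : R := clamp (3 * s - 1).
Definition tent s : R := clamp (3 * s) * clamp (3 - 3 * s).

Lemma ramp_continuous : continuous ramp.
Proof.
move=> s; apply: (@continuous_comp _ _ _ (fun s => 3 * s - 1) (@clamp R)).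
  exact: affine_continuous.
exact: clamp_continuous.
Qed.

Lemma tent_continuous : continuous tent.
Proof.
have clamp_comp (h : R -> R) :
    continuous h -> continuous (fun x => clamp (h x)).
  by move=> ch x; apply: continuous_comp; [exact: ch|exact: clamp_continuous].
move=> s; apply: (@continuousM _ _ (fun s => clamp (3 * s))
    (fun s => clamp (3 - 3 * s))).
  exact: clamp_comp (@mulrl_continuous _ 3) s.
apply: (@clamp_comp (fun s => 3 - 3 * s)) => x.
apply: (@continuous_comp R R R (fun x => 3 * x) (fun x => 3 - x)).
  exact: mulrl_continuous.
exact: subl_continuous.
Qed.

Lemma tent_itv s : 0 <= tent s <= 1.
Proof.
have /andP[? ?] := clamp_itv (3 * s); have /andP[? ?] := clamp_itv (3 - 3 * s).
by rewrite mulr_ge0//= mulr_ile1.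
Qed.

Lemma tent_endpoint s : s = 0 \/ s = 1 -> tent s = 0.
Proof.
rewrite /tent => -[->|->]; first by rewrite mulr0 clamp_le0// mul0r.
by rewrite mulr1 subrr [X in _ * X]clamp_le0// mulr0.
Qed.

Lemma tent_middle s : 1 <= 3 * s <= 2 -> tent s = 1.
Proof. by move=> /andP[? ?]; rewrite /tent !clamp_ge1 ?mulr1//; lra. Qed.

Lemma tent_ramp s : [\/ tent s = 1, ramp s = 0 | ramp s = 1].
Proof.
have [s1|s1] := leP (3 * s) 1.
  by constructor 2; rewrite /ramp clamp_le0//; lra.
have [s2|s2] := leP 2 (3 * s).
  by constructor 3; rewrite /ramp clamp_ge1//; lra.
by constructor 1; rewrite tent_middle// !ltW.
Qed.

Definition collar z : R := tent (z ord0 ord0) * tent (z ord0 ord_max).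
Definition xparam z : R := ramp (z ord0 ord0).
Definition yparam z : R := ramp (z ord0 ord_max).

(* The middle ninth of the square is mapped onto the facet opposite to the
   vertex 0, as the cone over its lower edge with apex the vertex 3, and the
   collar around it onto the cone with apex 0 over that facet's boundary. *)
Definition sphere_weights z : seq R :=
  [:: 1 - collar z; collar z * ((1 - yparam z) * (1 - xparam z));
      collar z * ((1 - yparam z) * xparam z); collar z * yparam z].

Lemma collar_itv z : 0 <= collar z <= 1.
Proof.
rewrite /collar; have /andP[? ?] := tent_itv (z ord0 ord0).
by have /andP[? ?] := tent_itv (z ord0 ord_max); rewrite mulr_ge0//= mulr_ile1.
Qed.

Fact sphere_coord_subproof z :
  (\row_(i < 4) (sphere_weights z)`_i) \in std_simplex R 3.
Proof.
have [ritv xitv yitv] : [/\ 0 <= collar z <= 1, 0 <= xparam z <= 1 &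
    0 <= yparam z <= 1] by split; [exact: collar_itv|exact: clamp_itv..].
apply/mem_set; rewrite /std_simplex/= /sphere_weights.
move: (collar z) (xparam z) (yparam z) ritv xitv yitv => r x y.
move=> /andP[? ?] /andP[? ?] /andP[? ?].
split=> [[[|[|[|[|//]]]] i]|]; rewrite ?mxE/= ?subr_ge0 ?mulr_ge0 ?subr_ge0//.
by rewrite !big_ord_recl big_ord0 !mxE/=; ring.
Qed.

Definition sphere_coord z : std_simplex R 3 :=
  exist (fun u => u \in std_simplex R 3) _ (sphere_coord_subproof z).

Lemma sphere_coord_continuous : continuous sphere_coord.
Proof.
have cont (h : R -> R) i : continuous h -> continuous (fun z => h (z ord0 i)).
  move=> ch z; apply: (@continuous_comp _ _ _ (fun z : 'rV[R]_2 => z ord0 i) h);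
    by [exact: coord_continuous|exact: ch].
have cB (h : 'rV[R]_2 -> R) : continuous h -> continuous (fun z => 1 - h z).
  move=> ch z; apply: (@continuous_comp _ _ _ h (fun x => 1 - x) z (ch z)).
  exact: subl_continuous.
have cM (h k : 'rV[R]_2 -> R) : continuous h -> continuous k ->
    continuous (fun z => h z * k z).
  by move=> ch ck z; apply: (@continuousM _ _ h k); [exact: ch|exact: ck].
have cx : continuous xparam := cont _ _ ramp_continuous.
have cy : continuous yparam := cont _ _ ramp_continuous.
have cr : continuous collar :=
  cM _ _ (cont _ _ tent_continuous) (cont _ _ tent_continuous).
apply: continuous_comp_initial; apply: row_continuous => j.
rewrite (_ : (fun z => _) = fun z => (sphere_weights z)`_j); last first.
  by apply/funext => z; rewrite mxE.
case: j => -[|[|[|[|//]]]] i.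
- exact: cB cr.
- exact: cM cr (cM _ _ (cB _ cy) (cB _ cx)).
- exact: cM cr (cM _ _ (cB _ cy) cx).
- exact: cM cr cy.
Qed.

Lemma sphere_coord_boundary z : exists i, val (sphere_coord z) ord0 i = 0.
Proof.
suff : collar z = 1 \/
    [\/ xparam z = 0, xparam z = 1, yparam z = 0 | yparam z = 1].
  case=> [zE|[zE|zE|zE|zE]]; [exists (inord 0)|exists (inord 2)|
    exists (inord 1)|exists (inord 3)|exists (inord 1)];
    by rewrite mxE inordK//= zE ?subrr ?mul0r ?mulr0.
rewrite /collar /xparam /yparam.
case: (tent_ramp (z ord0 ord0)) => x;
  [|by right; constructor 1|by right; constructor 2].
case: (tent_ramp (z ord0 ord_max)) => y;
  [|by right; constructor 3|by right; constructor 4].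
by left; rewrite x y mulr1.
Qed.

Context (G : groupType) (a b c : G).
Hypothesis nil2_triple : forall x : {ffun 'I_3 -> G}, affinely_nil2 G 2 x.

Definition tetrahedron : {ffun 'I_4 -> G} :=
  [ffun i : 'I_4 => nth 1%g [:: 1%g; a; b; c] i].

Definition sphere z : E3 G R :=
  @facet_point R G 1 tetrahedron (fun i => nil2_triple _) (sphere_coord z).

Lemma sphere_continuous : continuous sphere.
Proof.
apply: (boundary_point_continuous (@facet_compatible _ _ _ _)).
  exact: sphere_coord_continuous.
exact: sphere_coord_boundary.
Qed.

Lemma sphere_collar0 z z' :
  collar z = 0 -> collar z' = 0 -> sphere z = sphere z'.
Proof.
have apex u : collar u = 0 ->
    val (sphere_coord u) = \row_(i < 4) nth 0 [:: 1; 0; 0; 0] i.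
  move=> u0; apply/rowP => -[[|[|[|[|//]]]] i];
    by rewrite !mxE/= u0 ?mul0r ?subr0.
by move=> z0 z'0; congr facet_point; apply: val_inj; rewrite !apex.
Qed.

Lemma collar_boundary z i : z ord0 i = 0 \/ z ord0 i = 1 -> collar z = 0.
Proof.
rewrite /collar; case: (unliftP ord0 i) => [j ->|->] zi; last first.
  by rewrite (tent_endpoint zi) mul0r.
rewrite (_ : lift _ _ = ord_max) in zi; last first.
  by apply: val_inj; rewrite (ord1 j).
by rewrite (tent_endpoint zi) mulr0.
Qed.

Lemma collar0 : collar 0 = 0.
Proof. by apply: (@collar_boundary _ ord0); left; rewrite mxE. Qed.

Lemma sphere_boundary z : cube_boundary R 2 z -> sphere z = sphere 0.
Proof.
by move=> [_ [i zi]]; apply: sphere_collar0 collar0; exact: collar_boundary zi.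
Qed.

Lemma label_sphere F g z : label F g (sphere z) ->
  [\/ g = 1%g /\ collar z != 1,
      [/\ g = a, collar z != 0, xparam z != 1 & yparam z != 1],
      [/\ g = b, collar z != 0, xparam z != 0 & yparam z != 1] |
      [/\ g = c, collar z != 0 & yparam z != 0]].
Proof.
have [i zi] := sphere_coord_boundary z => /(label_facet_point zi)[j [<-]].
rewrite ffunE mxE; case: j => -[|[|[|[|//]]]] ? /=;
  rewrite ?mulf_eq0 ?subr_eq0 2?[1 == _]eq_sym.
- by constructor 1.
- by move=> /norP[? /norP[? ?]]; constructor 2.
- by move=> /norP[? /norP[? ?]]; constructor 3.
- by move=> /norP[? ?]; constructor 4.
Qed.

Lemma label_sphere0 F g : label F g (sphere 0) -> g = 1%g.
Proof.
by move=> /label_sphere; rewrite collar0 eqxx => -[[]|[]|[]|[]].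
Qed.

End Sphere.

(** * Nullhomotopies *)

Section Prism.
Context (R : realType).

Definition prism : set ('rV[R]_2 * R) := cube R 2 `*` `[0, 1].

Lemma compact_prism : compact prism.
Proof.
apply: compact_setX; last exact: segment_compact.
rewrite (_ : cube R 2 = [set v | forall i, `[0, 1]%classic (v ord0 i)]).
  apply: (@rV_compact R 2 (fun=> `[0, 1]%classic)) => i.
  exact: segment_compact.
by apply/seteqP; split=> t /= ct i; have := ct i; rewrite /= in_itv.
Qed.

Let avg_itv (x y s : R) : 0 <= s <= 1 -> 0 <= x <= 1 -> 0 <= y <= 1 ->
  0 <= s * x + (1 - s) * y <= 1.
Proof.
by move=> /andP[? ?] /andP[? ?] /andP[? ?]; apply/andP; split; nra.
Qed.

Lemma convex_cube n : convex_set (cube R n : set (convex_lmodType 'rV[R]_n)).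
Proof.
apply/convex_setP => v w s s01 v01 w01 i; rewrite !mxE.
exact: avg_itv.
Qed.

Lemma convex_prism :
  convex_set (prism : set (convex_lmodType ('rV[R]_2 * R)%type)).
Proof.
apply/convex_setP => v w s s01 [v1 v2] [w1 w2]; split.
  by have /convex_setP := @convex_cube 2; exact.
by move: v2 w2; rewrite /= !in_itv/=; exact: avg_itv.
Qed.

Context (N : nat).
Implicit Types p q : nat * nat * nat.

Definition grid p : 'rV[R]_2 * R :=
  (\row_(i < 2) nth 0 [:: p.1.1%:R / N%:R; p.1.2%:R / N%:R] i, p.2%:R / N%:R).

Hypothesis N_gt0 : (0 < N)%N.

Lemma grid_prism p : grid_adj N p p -> prism (grid p).
Proof.
move=> /andP[/and4P[p1 p2 p3 _] _].
have itv k : (k <= N)%N -> 0 <= (k%:R / N%:R : R) <= 1.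
  by move=> kN; rewrite divr_ge0//= ler_pdivrMr ?ltr0n// mul1r ler_nat.
split=> /=; last by rewrite in_itv/= itv.
by move=> [[|[|//]] i]; rewrite mxE/= itv.
Qed.

Lemma grid_ball e p q :
  N%:R^-1 < e -> grid_adj N p q -> ball (grid p) e (grid q).
Proof.
move=> Ne /andP[_ /and5P[p1 q1 p2 q2 /andP[p3 q3]]].
have dist k l : (k <= l.+1)%N -> (l <= k.+1)%N ->
    `|k%:R / N%:R - l%:R / N%:R| < e.
  rewrite -!(ler_nat R) -!natr1 => kl lk; apply: le_lt_trans Ne.
  have N0 : 0 <= N%:R^-1 :> R by rewrite invr_ge0.
  rewrite -mulrBl normrM (ger0_norm N0) ler_piMl// ler_norml.
  by apply/andP; split; lra.
split=> /=; last exact: dist.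
split; first by apply: lt_trans Ne; rewrite invr_gt0 ltr0n.
by move=> i [[|[|//]] j]; rewrite !mxE/=; exact: dist.
Qed.

End Prism.

Section GridThirds.
Context (R : realType) (M : nat).
Hypothesis M_gt0 : (0 < M)%N.

Let x k : R := k%:R / (3 * M)%:R.

Let third k : 3 * x k = k%:R / M%:R.
Proof. by rewrite /x natrM; field; rewrite pnatr_eq0 -lt0n. Qed.

Let M_natr_gt0 : 0 < M%:R :> R. Proof. by rewrite ltr0n. Qed.

Lemma ramp_grid_neq0 k : ramp (x k) != 0 -> (M < k)%N.
Proof.
rewrite /ramp third; apply: contraR; rewrite -leqNgt -(ler_nat R) => kM.
by rewrite clamp_le0// subr_le0 ler_pdivrMr ?mul1r.
Qed.

Lemma ramp_grid_neq1 k : ramp (x k) != 1 -> (k < 2 * M)%N.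
Proof.
rewrite /ramp third; apply: contraR; rewrite -leqNgt -(ler_nat R) natrM => kM.
have k2 : 2 <= k%:R / M%:R :> R by rewrite ler_pdivlMr.
by rewrite clamp_ge1//; lra.
Qed.

Lemma tent_grid_middle k : (M <= k <= 2 * M)%N -> tent (x k) = 1.
Proof.
rewrite -!(ler_nat R) natrM => /andP[k1 k2]; apply: tent_middle.
by rewrite third ler_pdivlMr// ler_pdivrMr// mul1r k1.
Qed.

End GridThirds.

Section NullHomotopy.
Context (R : realType) (G : groupType) (A : zmodType) (om : G -> G -> G -> A).
Hypothesis alt : alternating3 om.
Hypothesis nil2_flat : forall n (x : {ffun 'I_n.+1 -> G}) i j k l,
  affinely_nil2 G n x ->
  om ((x i)^-1 * x j)%g ((x i)^-1 * x k)%g ((x i)^-1 * x l)%g = 0.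
Hypothesis nil2_triple : forall x : {ffun 'I_3 -> G}, affinely_nil2 G 2 x.
Context (a b c : G).

Notation sph := (@sphere R G a b c nil2_triple).
Notation proj := (class_of (@E3_orbit G R)).
Notation base := (proj (sph 0)).

Lemma transition_base F F' g : transition F F' g base -> g = 1%g.
Proof.
move=> /transition_class[h [/label_sphere0 -> /label_sphere0]].
by rewrite mul1g.
Qed.

Context (H : 'rV[R]_2 * R -> B3 G R).
Hypothesis H_continuous : {within @prism R, continuous H}.
Hypothesis H_bottom : forall t, cube R 2 t -> H (t, 0) = proj (sph t).
Hypothesis H_top : forall t, cube R 2 t -> H (t, 1) = base.
Hypothesis H_side : forall t s, cube_boundary R 2 t -> 0 <= s <= 1 ->
  H (t, s) = base.

Section FineGrid.
Context (N : nat) (e : R) (F : nat * nat * nat -> R -> R).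
Implicit Types p q r : nat * nat * nat.
Hypothesis N_gt0 : (0 < N)%N.
Hypothesis e_gt : N%:R^-1 < e.
Hypothesis F_cdf : forall p, cdf (F p).
Hypothesis labelled_ball : forall p z, grid_adj N p p -> prism z ->
  ball (grid R N p) e z -> labelled (F p) (H z).

Notation point := (grid R N).

Let tau p q : G := xget 1%g [set g | transition (F p) (F q) g (H (point p))].

Let tau_transition p q : grid_adj N p q ->
  transition (F p) (F q) (tau p q) (H (point p)).
Proof.
move=> pq; have pp := grid_adj_refll pq; have qq := grid_adj_reflr pq.
have gp := grid_prism R N_gt0 pp.
apply: (@xgetPex _ 1%g [set g | transition (F p) (F q) g (H (point p))]).
apply: transition_exists; apply: labelled_ball => //; apply: grid_ball => //.
by rewrite grid_adjC.
Qed.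

Let tau_transition_near p q r : grid_adj N p q -> grid_adj N p r ->
  grid_adj N q r -> transition (F p) (F q) (tau p q) (H (point r)).
Proof.
move=> pq pr qr; have pp := grid_adj_refll pq; have qq := grid_adj_refll qr.
have rr := grid_adj_reflr pr; have qp : grid_adj N q p by rewrite grid_adjC.
pose B := @prism R `&` ball (point p) e `&` ball (point q) e.
apply: (@connected_constant _ _ _ B (transition (F p) (F q)) H (tau p q)
  (point p) (point r)).
- apply: convex_set_connected; apply: convex_setI; last exact: convex_set_ball.
  by apply: convex_setI; [exact: convex_prism|exact: convex_set_ball].
- by apply: continuous_subspaceW H_continuous => z [[]].
- by move=> g; exact: open_transition.
- by move=> g g' b'; exact: transition_unique.
- move=> z [[zP zp] zq].
  by apply: transition_exists; exact: labelled_ball.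
- by split; [split; [exact: grid_prism|exact: grid_ball]|exact: grid_ball].
- by split; [split; [exact: grid_prism|exact: grid_ball]|exact: grid_ball].
- exact: tau_transition.
Qed.

Let tau_cocycle p q r : grid_adj N p q -> grid_adj N q r -> grid_adj N p r ->
  (tau p q * tau q r)%g = tau p r.
Proof.
move=> pq qr pr.
apply: (@transition_unique R G (F p) (F r) _ _ (H (point p))) => //.
  apply: (transition_comp _ (tau_transition pq)) => //.
  by apply: tau_transition_near; rewrite // grid_adjC.
exact: tau_transition.
Qed.

Let y := potential tau N.

Let yE p q : grid_adj N p q -> ((y p)^-1 * y q)%g = tau p q.
Proof. exact: potentialE tau_cocycle _ _. Qed.

Let H_lid p : grid_adj N p p -> on_lid N p -> H (point p) = base.
Proof.
move=> pp; have [ct k01] := grid_prism R N_gt0 pp.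
have NN : N%:R / N%:R = 1 :> R by rewrite divff// pnatr_eq0 -lt0n.
have side i : (point p).1 ord0 i = 0 \/ (point p).1 ord0 i = 1 ->
    H (point p) = base.
  move=> pi; rewrite [point p]surjective_pairing; apply: H_side.
    by split=> //; exists i.
  by move: k01; rewrite /= in_itv.
move=> /or4P[/eqP p1|/eqP p1|/eqP p2|/orP[/eqP p2|/eqP p3]].
- by apply: (side ord0); left; rewrite mxE/= p1 mul0r.
- by apply: (side ord0); right; rewrite mxE/= p1.
- by apply: (side ord_max); left; rewrite mxE/= p2 mul0r.
- by apply: (side ord_max); right; rewrite mxE/= p2.
- by rewrite [point p]surjective_pairing (_ : (point p).2 = 1) ?H_top//= p3.
Qed.

Let y_lid p q : grid_adj N p q -> on_lid N p -> y q = y p.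
Proof.
move=> pq lp; apply: (mulgI (y p)^-1%g); rewrite yE// mulVg.
apply: transition_base; rewrite -(H_lid (grid_adj_refll pq) lp).
exact: tau_transition.
Qed.

Let y_flat p q r s : grid_adj N p q -> grid_adj N p r -> grid_adj N p s ->
  om ((y p)^-1 * y q)%g ((y p)^-1 * y r)%g ((y p)^-1 * y s)%g = 0.
Proof.
move=> pq pr ps; rewrite !yE//.
by apply: (transition_flat nil2_flat (F_cdf p)); exact: tau_transition.
Qed.

Let labelled_bottom p t : grid_adj N p p -> p.2 = 0%N -> cube R 2 t ->
  ball (point p).1 e t -> exists g, label (F p) g (sph t).
Proof.
move=> pp p0 ct pt; apply/labelled_class; rewrite -H_bottom//.
apply: labelled_ball => //; first by split=> //=; rewrite in_itv/= lexx ler01.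
split=> //=; rewrite p0 mul0r; apply: ballxx; apply: le_lt_trans e_gt.
by rewrite invr_ge0.
Qed.

Let label_bottom_adj p q g : grid_adj N p q -> p.2 = 0%N -> q.2 = 0%N ->
  label (F p) g (sph (point p).1) ->
  label (F q) (g * tau p q)%g (sph (point q).1).
Proof.
move=> pq p0 q0 lp; have pp := grid_adj_refll pq.
have qq := grid_adj_reflr pq; have qp : grid_adj N q p by rewrite grid_adjC.
have [cp _] := grid_prism R N_gt0 pp; have [cq _] := grid_prism R N_gt0 qq.
have lqp : label (F q) (g * tau p q)%g (sph (point p).1).
  have := tau_transition pq.
  rewrite [point p]surjective_pairing [(point p).2]/= p0 mul0r H_bottom//.
  move=> /transition_class[h [lh lh']].
  by rewrite (label_unique (F_cdf p) lp lh).
pose B := cube R 2 `&` ball (point q).1 e.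
apply: (@connected_constant _ _ _ B (label (F q)) sph _ (point p).1 (point q).1)
  lqp.
- apply: convex_set_connected; apply: convex_setI; last exact: convex_set_ball.
  exact: convex_cube.
- by apply: continuous_subspaceT; exact: sphere_continuous.
- by move=> h; exact: open_label.
- by move=> h k x; exact: label_unique.
- by move=> z [cz qz]; exact: labelled_bottom.
- by split=> //; have [] := grid_ball N_gt0 e_gt qp.
- by split=> //; have [] := grid_ball N_gt0 e_gt qq.
Qed.

Let label_potential n p : grid_adj N p p -> p.2 = 0%N ->
  label (F (truncate n p)) (potential tau n p) (sph (point (truncate n p)).1).
Proof.
move=> pp p0; have bot k : (truncate k p).2 = 0%N by rewrite /= p0 min0n.
elim: n => [|n IH]; last first.
  by apply: label_bottom_adj; rewrite ?bot//; exact: grid_adj_truncateS.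
have origin_adj : grid_adj N (truncate 0 p) (truncate 0 p).
  exact: grid_adj_truncate.
have [co _] := grid_prism R N_gt0 origin_adj.
have [|g lg] := labelled_bottom origin_adj (bot _) co.
  by have [] := grid_ball N_gt0 e_gt origin_adj.
have origin0 : (point (truncate 0 p)).1 = 0.
  by apply/rowP => -[[|[|//]] i]; rewrite truncate0 !mxE/= mul0r.
rewrite origin0 in lg; rewrite origin0 -[potential _ _ _](label_sphere0 lg).
exact: lg.
Qed.

Let label_y i j : (i <= N)%N -> (j <= N)%N ->
  label (F (i, j, 0%N)) (y (i, j, 0%N)) (sph (point (i, j, 0%N)).1).
Proof.
move=> iN jN; have ij : grid_adj N (i, j, 0%N) (i, j, 0%N).
  by rewrite /grid_adj/=; lia.
by have := @label_potential N _ ij erefl; rewrite truncate_id.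
Qed.

Lemma fine_grid_alt3_eq0 M : N = (3 * M)%N -> om a b c = 0.
Proof.
move=> NM; have M_gt0 : (0 < M)%N by lia.
rewrite -(bottom_slab_eq0 alt y_flat y_lid) /slab NM.
symmetry; apply: (sum_quad_sperner alt) => // i j iM jM.
have := @label_y i j; rewrite NM => /(_ iM jM) /label_sphere.
rewrite /collar /xparam /yparam !mxE/=.
case=> [[-> r1]|[-> _ x1 y1]|[-> _ x0 y1]|[-> _ y0]].
- constructor; apply: contra r1 => /andP[ij ji].
  by rewrite !(tent_grid_middle _ M_gt0) ?mulr1.
- by apply: ColourA; [exact: ramp_grid_neq1 M_gt0 _ x1|
    exact: ramp_grid_neq1 M_gt0 _ y1].
- apply: ColourB; first exact: ramp_grid_neq0 M_gt0 _ x0.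
  exact: ramp_grid_neq1 M_gt0 _ y1.
- by apply: ColourC; exact: ramp_grid_neq0 M_gt0 _ y0.
Qed.

End FineGrid.

Lemma nullhomotopic_alt3_eq0 : om a b c = 0.
Proof.
pose U (F : {F : R -> R | cdf F}) := labelled (sval F) : set (B3 G R).
have [|x|e e_gt0 e_lebesgue] :=
  lebesgue_number (U := U) (@compact_prism R) H_continuous.
- by move=> [F F_cdf]; exact: open_transition.
- by have [F [F_cdf Fx]] := labelled_exists x; exists (exist _ F F_cdf).
have [M M_gt] : exists M, M.+1%:R^-1 < e.
  have := near_infty_natSinv_lt (PosNum e_gt0); case=> M _ Me.
  by exists M; exact: (Me M (leqnn M)).
pose N := (3 * M.+1)%N; have N_gt0 : (0 < N)%N by [].
have e_gt : N%:R^-1 < e.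
  by apply: le_lt_trans M_gt; rewrite lef_pV2 ?posrE ?ltr0n// ler_nat /N; lia.
have [F F_ball] : {F : nat * nat * nat -> {F : R -> R | cdf F} &
    forall p, grid_adj N p p -> forall z, prism z -> ball (grid R N p) e z ->
      U (F p) (H z)}.
  apply: (@choice _ _ (fun p F => grid_adj N p p -> forall z, prism z ->
      ball (grid R N p) e z -> U F (H z))) => p.
  have [pp|npp] := boolP (grid_adj N p p).
    by have [F FP] := e_lebesgue _ (grid_prism R N_gt0 pp); exists F.
  by have [F [F_cdf _]] := labelled_exists base; exists (exist _ F F_cdf).
apply: (@fine_grid_alt3_eq0 N e (fun p => sval (F p)) N_gt0 e_gt _ _ M.+1) =>
  // [p|p z pp pz].
  by case: (F p).
exact: F_ball.
Qed.

End NullHomotopy.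

Lemma B3_pi2_nontrivial (R : realType) (G : groupType) :
  two_engel G -> nilpotency_class 3 [set: G] ->
  exists (x0 : B3 G R) (u v : homotopy_group R 2 x0), u <> v.
Proof.
move=> engel class3; have [a [b [c abc]]] := comm3_neq0 class3.
have triple := affinely_nil2_triple engel class3.
pose f t : B3 G R := class_of (@E3_orbit G R) (@sphere R G a b c triple t).
have f_boundary t : cube_boundary R 2 t -> f t = f 0.
  by move=> /(sphere_boundary a b c triple) ft; rewrite /f ft.
have f_within : {within cube R 2, continuous f}.
  apply: continuous_subspaceT => t; apply: continuous_comp.
    exact: sphere_continuous.
  exact: class_of_continuous.
have cst_within : {within cube R 2, continuous (fun=> f 0)}.
  by apply: continuous_subspaceT => t; exact: cst_continuous.
exists (f 0), (hclass (NLoop f_within f_boundary)),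
  (hclass (NLoop cst_within (fun _ _ => erefl))).
move=> /hclass_homotopic[H [H_within H_bottom H_top H_side]].
move/eqP: abc; apply; apply: (nullhomotopic_alt3_eq0
  (comm3_alternating engel class3) _ H_within H_bottom H_top H_side).
by move=> n x i j l m; exact: comm3_affinely_nil2.
Qed.

Theorem corollary2p11 (R : realType) (G : groupType)
  (hEngel : two_engel G) (hclass3 : nilpotency_class 3 [set: G])
  (P : groupType) :
  ~ eilenberg_maclane1 R (B3 G R) P.
Proof.
have [x0 [u [v uv]]] := B3_pi2_nontrivial R hEngel hclass3.
by move=> [_ /(_ x0)[_ /(_ 2%N isT u v)]].
Qed.
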